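(* The system $\mathrm{RCA}_0^\omega$ proves that any net-closed set in $\mathbb{R}$ is closed. Here a set $F\subseteq\mathbb{R}$ is net-closed if for any net $x_d:D\to\mathbb{R}$ (indexed by a subset $D$ of Baire space) and any $x\in\mathbb{R}$: $[(\forall d\in D)(x_d\in F)\wedge\lim_dx_d=x]\to x\in F$.
   Context: Base theory. Finite types: $0$ (natural numbers) is a type, and if $\sigma,\tau$ are types then so is $\sigma\to\tau$ (mappings from type $\sigma$ to type $\tau$ objects); $1:=0\to0$ and $n+1:=n\to0$; a superscript on a variable is its type. $L_\omega$ is the language with variables and quantifiers of all finite types, constants $0,1,<_0,+_0,\times_0,=_0$ on $\mathbb{N}$, the combinators $\Pi,\Sigma$ and a recursor constant $\mathbf{R}_0$. Equality at higher types is defined extensionally: $x=_\tau y$ iff $xz_1\dots z_k=_0yz_1\dots z_k$ for all arguments. $\mathrm{QF\text{-}AC}^{\sigma,\tau}$ is the schema $(\forall x^\sigma)(\exists y^\tau)A(x,y)\to(\exists Y^{\sigma\to\tau})(\forall x^\sigma)A(x,Y(x))$ for quantifier-free $A$ of $L_\omega$ (parameters of any type allowed). $\mathrm{RCA}_0^\omega$ is the theory in $L_\omega$ with classical logic and the axioms: $\mathbb{N}$ is an ordered semi-ring; the defining axioms of $\Pi,\Sigma$ (giving $\lambda$-abstraction); $\mathbf{R}_0(f,m,0)=m$ and $\mathbf{R}_0(f,m,n+1)=f(n,\mathbf{R}_0(f,m,n))$; extensionality $x=_\rho y\to\varphi(x)=_\tau\varphi(y)$ for all types $\rho,\tau$ and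 $\varphi^{\rho\to\tau}$; induction for quantifier-free formulas of $L_\omega$; $\mathrm{QF\text{-}AC}^{1,0}$. Reals. A real is a sequence of rationals $(q_n)$ with $|q_n-q_{n+i}|<2^{-n}$ for all $n,i$ (a type 1 object); $(q_n)=_{\mathbb{R}}(r_n)$ iff $|q_n-r_n|\le2^{-n+1}$ for all $n$. A function $\mathbb{R}\to\mathbb{R}$ is a type $1\to1$ functional mapping equal reals to equal reals. Open and closed sets. In this statement, subsets $F$ of $\mathbb{R}$ are represented by functions $F:\mathbb{R}\to\mathbb{R}$, where $x\in F$ stands for $|F(x)|>_{\mathbb{R}}0$. The complement $F^c$ is given by $x\in F^c\leftrightarrow\neg(x\in F)$. A set is open if for each of its points $x$ there is a rational $r>0$ (coded as a type 0 object) such that the open ball $B(x,r)$ is contained in the set. A set $F$ is closed if its complement $F^c$ is open. Index sets. A subset $D$ of Baire space $\mathbb{N}^{\mathbb{N}}$ is given by a characteristic function $F_D^2\le1$ ($f\in D$ means $F_D(f)=1$); a binary relation $\preceq$ on $D$ is likewise given by a characteristic function of type $(1\times1)\to0$. Via extensionality with respect to $=_{\mathbb{R}}$, index sets consisting of reals, and relations on them, are included. Nets. $(D,\preceq)$ with $D\neq\emptyset$ is directed if $\preceq$ is transitive and reflexive on $D$ and for all $x,y\in D$ there is $z\in D$ with $x\preceq z$ and $y\preceq z$. A net in $\mathbb{R}$ is a map $x_d:D\to\mathbb{R}$ with $(D,\preceq)$ directed, $D$ a subset of Baire space given by a characteristic function $F_D^2\le1$, and $\preceq$ given by a characteristic function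 of type $(1\times1)\to0$ (index sets consisting of reals being included). It converges to $y$, written $\lim_dx_d=y$, if $(\forall\varepsilon>0)(\exists d_0\in D)(\forall e\succeq d_0)(|x_e-y|<\varepsilon)$. *)

(* Defs.v *)
From Stdlib Require Import List.
Import ListNotations.

Set Implicit Arguments.
Unset Strict Implicit.
Unset Printing Implicit Defensive.
Set Contextual Implicit.

(* Syntax is intrinsically typed: [tm G s] is the set of terms of type [s]
    whose free variables are declared (de Bruijn style) in the context [G]. *)

Inductive ty : Type :=
| nat0 : ty
| arr : ty -> ty -> ty.

Declare Scope ty_scope.
Delimit Scope ty_scope with ty.
Bind Scope ty_scope with ty.
Notation "s ⇒ t" := (arr s t) (at level 55, right associativity) : ty_scope.
Local Open Scope ty_scope.

Notation "'O0'" := nat0.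
Notation "'O1'" := (nat0 ⇒ nat0).

Definition ctx := list ty.

Inductive var : ctx -> ty -> Type :=
| vz : forall G s, var (s :: G) s
| vs : forall G s t, var G s -> var (t :: G) s.

Inductive tm (G : ctx) : ty -> Type :=
| tvar : forall s, var G s -> tm G s
| tapp : forall s t, tm G (s ⇒ t) -> tm G s -> tm G t
| tzero : tm G O0
| tone : tm G O0
| tplus : tm G (O0 ⇒ O0 ⇒ O0)
| ttimes : tm G (O0 ⇒ O0 ⇒ O0)
| tPi : forall s t, tm G (s ⇒ t ⇒ s)
| tSigma : forall r s t, tm G ((r ⇒ s ⇒ t) ⇒ (r ⇒ s) ⇒ r ⇒ t)
| tRec : tm G ((O0 ⇒ O0 ⇒ O0) ⇒ O0 ⇒ O0 ⇒ O0).

Inductive fm (G : ctx) : Type :=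
| feq : tm G O0 -> tm G O0 -> fm G
| flt : tm G O0 -> tm G O0 -> fm G
| fbot : fm G
| fimp : fm G -> fm G -> fm G
| fand : fm G -> fm G -> fm G
| for_ : fm G -> fm G -> fm G
| fall : forall s, fm (s :: G) -> fm G
| fex : forall s, fm (s :: G) -> fm G.

Declare Scope tm_scope.
Delimit Scope tm_scope with tm.
Bind Scope tm_scope with tm.
Declare Scope fm_scope.
Delimit Scope fm_scope with fm.
Bind Scope fm_scope with fm.

Notation "f · a" := (tapp f a) (at level 20, left associativity) : tm_scope.
Notation "0" := tzero : tm_scope.
Notation "1" := tone : tm_scope.
Notation "a + b" := (tapp (tapp tplus a) b) : tm_scope.
Notation "a * b" := (tapp (tapp ttimes a) b) : tm_scope.

Notation "a ≡ b" := (feq a b) (at level 70, no associativity) : fm_scope.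
Notation "a ≺ b" := (flt a b) (at level 70, no associativity) : fm_scope.
Notation "⊥" := fbot : fm_scope.
Notation "A ⊃ B" := (fimp A B) (at level 90, right associativity) : fm_scope.
Notation "A ⋀ B" := (fand A B) (at level 80, right associativity) : fm_scope.
Notation "A ⋁ B" := (for_ A B) (at level 85, right associativity) : fm_scope.
Notation "∼ A" := (fimp A fbot) (at level 75, right associativity) : fm_scope.
Notation "∀[ s ] A" := (fall (s := s) A) (at level 95, right associativity) : fm_scope.
Notation "∃[ s ] A" := (fex (s := s) A) (at level 95, right associativity) : fm_scope.

Notation v0 := (tvar vz).
Notation v1 := (tvar (vs vz)).
Notation v2 := (tvar (vs (vs vz))).
Notation v3 := (tvar (vs (vs (vs vz)))).

Definition ren (G D : ctx) : Type := forall s, var G s -> var D s.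
Definition sub (G D : ctx) : Type := forall s, var G s -> tm D s.

(* [vcase z f] is the assignment sending the most recent variable to [z] and
   the others according to [f]. *)
Definition vcase (P : ty -> Type) (G : ctx) (s : ty) (z : P s)
    (f : forall t, var G t -> P t) : forall t, var (s :: G) t -> P t :=
  fun t x =>
    match x in var G' t' return
      match G' with
      | [] => unit
      | s' :: G'' => P s' -> (forall t, var G'' t -> P t) -> P t'
      end
    with
    | vz => fun z _ => z
    | vs y => fun _ f => f _ y
    end z f.

Definition rup (G D : ctx) (s : ty) (r : ren G D) : ren (s :: G) (s :: D) :=
  vcase (P := var (s :: D)) vz (fun _ x => vs (r _ x)).

Fixpoint tren (G D : ctx) (r : ren G D) (s : ty) (a : tm G s) : tm D s :=
  match a with
  | tvar x => tvar (r _ x)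
  | tapp f b => tapp (tren r f) (tren r b)
  | tzero => tzero
  | tone => tone
  | tplus => tplus
  | ttimes => ttimes
  | tPi => tPi
  | tSigma => tSigma
  | tRec => tRec
  end.

Fixpoint fren (G D : ctx) (r : ren G D) (A : fm G) : fm D :=
  match A with
  | feq a b => feq (tren r a) (tren r b)
  | flt a b => flt (tren r a) (tren r b)
  | fbot => fbot
  | fimp A B => fimp (fren r A) (fren r B)
  | fand A B => fand (fren r A) (fren r B)
  | for_ A B => for_ (fren r A) (fren r B)
  | fall A => fall (fren (rup r) A)
  | fex A => fex (fren (rup r) A)
  end.

Definition twk (G : ctx) (t s : ty) (a : tm G s) : tm (t :: G) s :=
  tren (fun _ x => vs x) a.
Definition fwk (G : ctx) (t : ty) (A : fm G) : fm (t :: G) :=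
  fren (fun _ x => vs x) A.

Notation "↑ a" := (twk a) (at level 10, a at level 10) : tm_scope.

Definition sup (G D : ctx) (s : ty) (r : sub G D) : sub (s :: G) (s :: D) :=
  vcase (P := tm (s :: D)) v0 (fun _ x => twk (r _ x)).

Fixpoint tsub (G D : ctx) (r : sub G D) (s : ty) (a : tm G s) : tm D s :=
  match a with
  | tvar x => r _ x
  | tapp f b => tapp (tsub r f) (tsub r b)
  | tzero => tzero
  | tone => tone
  | tplus => tplus
  | ttimes => ttimes
  | tPi => tPi
  | tSigma => tSigma
  | tRec => tRec
  end.

Fixpoint fsub (G D : ctx) (r : sub G D) (A : fm G) : fm D :=
  match A with
  | feq a b => feq (tsub r a) (tsub r b)
  | flt a b => flt (tsub r a) (tsub r b)
  | fbot => fbot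
  | fimp A B => fimp (fsub r A) (fsub r B)
  | fand A B => fand (fsub r A) (fsub r B)
  | for_ A B => for_ (fsub r A) (fsub r B)
  | fall A => fall (fsub (sup r) A)
  | fex A => fex (fsub (sup r) A)
  end.

Definition scons (G D : ctx) (s : ty) (a : tm D s) (r : sub G D) : sub (s :: G) D :=
  vcase (P := tm D) a r.

Definition finst (G : ctx) (s : ty) (A : fm (s :: G)) (a : tm G s) : fm G :=
  fsub (scons a (fun _ x => tvar x)) A.

Definition theory := forall G : ctx, fm G -> Prop.

(* [prf T H A]: [A] is derivable from the axioms of [T] and the hypotheses [H]
   in natural deduction.  Axioms of [T] may have free variables (parameters). *)
Inductive prf (T : theory) (G : ctx) (H : list (fm G)) : fm G -> Prop :=
| prf_ax : forall A, T G A -> prf T H A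
| prf_hyp : forall A, In A H -> prf T H A
| prf_impI : forall A B, prf T (A :: H) B -> prf T H (A ⊃ B)
| prf_impE : forall A B, prf T H (A ⊃ B) -> prf T H A -> prf T H B
| prf_andI : forall A B, prf T H A -> prf T H B -> prf T H (A ⋀ B)
| prf_andE1 : forall A B, prf T H (A ⋀ B) -> prf T H A
| prf_andE2 : forall A B, prf T H (A ⋀ B) -> prf T H B
| prf_orI1 : forall A B, prf T H A -> prf T H (A ⋁ B)
| prf_orI2 : forall A B, prf T H B -> prf T H (A ⋁ B)
| prf_orE : forall A B C,
    prf T H (A ⋁ B) -> prf T (A :: H) C -> prf T (B :: H) C -> prf T H C
| prf_botE : forall A, prf T H ⊥ -> prf T H A
| prf_dne : forall A, prf T H (∼ ∼ A) -> prf T H A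
| prf_allI : forall s (A : fm (s :: G)),
    prf T (map (@fwk G s) H) A -> prf T H (∀[s] A)
| prf_allE : forall s (A : fm (s :: G)) (a : tm G s),
    prf T H (∀[s] A) -> prf T H (finst A a)
| prf_exI : forall s (A : fm (s :: G)) (a : tm G s),
    prf T H (finst A a) -> prf T H (∃[s] A)
| prf_exE : forall s (A : fm (s :: G)) (C : fm G),
    prf T H (∃[s] A) -> prf T (A :: map (@fwk G s) H) (fwk C) -> prf T H C
| prf_refl : forall a, prf T H (a ≡ a)
| prf_leibniz : forall (A : fm (O0 :: G)) (a b : tm G O0),
    prf T H (a ≡ b) -> prf T H (finst A a) -> prf T H (finst A b).

Definition provable (T : theory) (A : fm []) : Prop := prf T [] A.

(* Extensional equality: x z1 ... zk = y z1 ... zk at type 0, for all z1, ..., zk. *)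
Fixpoint eqt (s : ty) : forall G, tm G s -> tm G s -> fm G :=
  match s with
  | nat0 => fun G a b => (a ≡ b)%fm
  | arr s t => fun G f g => (∀[s] eqt (↑f · v0) (↑g · v0))%fm
  end.

Fixpoint qf (G : ctx) (A : fm G) : Prop :=
  match A with
  | feq _ _ | flt _ _ | fbot => True
  | fimp A B | fand A B | for_ A B => qf A /\ qf B
  | fall _ | fex _ => False
  end.

(* Non-negativity, discreteness and the predecessor axioms follow by quantifier-free
   induction, so only the ordered semi-ring axioms proper are listed. *)
Inductive ordered_semiring (G : ctx) : fm G -> Prop :=
| os_addA : forall a b c, ordered_semiring (a + (b + c) ≡ a + b + c)
| os_addC : forall a b, ordered_semiring (a + b ≡ b + a)
| os_add0 : forall a, ordered_semiring (a + 0 ≡ a)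
| os_mulA : forall a b c, ordered_semiring (a * (b * c) ≡ a * b * c)
| os_mulC : forall a b, ordered_semiring (a * b ≡ b * a)
| os_mul1 : forall a, ordered_semiring (a * 1 ≡ a)
| os_mul0 : forall a, ordered_semiring (a * 0 ≡ 0)
| os_mulD : forall a b c, ordered_semiring (a * (b + c) ≡ a * b + a * c)
| os_lt_irr : forall a, ordered_semiring (∼ (a ≺ a))
| os_lt_trans : forall a b c, ordered_semiring (a ≺ b ⊃ b ≺ c ⊃ a ≺ c)
| os_lt_total : forall a b, ordered_semiring (a ≺ b ⋁ a ≡ b ⋁ b ≺ a)
| os_lt_add : forall a b c, ordered_semiring (a ≺ b ⊃ a + c ≺ b + c)
| os_lt_mul : forall a b c, ordered_semiring (0 ≺ c ⊃ a ≺ b ⊃ a * c ≺ b * c)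
| os_lt01 : ordered_semiring (0 ≺ 1).

(* [A] has [v0] as the induction variable. *)
Definition induction_for (G : ctx) (A : fm (O0 :: G)) : fm G :=
  finst A 0
  ⊃ (∀[O0] A ⊃ fsub (scons (v0 + 1)%tm (fun _ x => tvar (vs x))) A)
  ⊃ (∀[O0] A).

(* In [A], [v1] is x of type [s] and [v0] is y of type [t]; the substitution in
   the conclusion replaces y by Y(x) underneath the quantifiers on Y and x. *)
Definition choice_for (G : ctx) (s t : ty) (A : fm (t :: s :: G)) : fm G :=
  (∀[s] ∃[t] A)
  ⊃ (∃[s ⇒ t] ∀[s]
       fsub (scons (v1 · v0)%tm (scons v0 (fun _ x => tvar (vs (vs x))))) A).

Inductive RCA0omega (G : ctx) : fm G -> Prop :=
| rca_semiring : forall A, ordered_semiring A -> RCA0omega A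
| rca_Pi : forall s t (x : tm G s) (y : tm G t),
    RCA0omega (eqt (tPi · x · y) x)
| rca_Sigma : forall r s t
    (x : tm G (r ⇒ s ⇒ t)) (y : tm G (r ⇒ s)) (z : tm G r),
    RCA0omega (eqt (tSigma · x · y · z) (x · z · (y · z)))
| rca_Rec0 : forall f m, RCA0omega (tRec · f · m · 0 ≡ m)
| rca_RecS : forall f m n,
    RCA0omega (tRec · f · m · (n + 1) ≡ f · n · (tRec · f · m · n))
| rca_ext : forall s t (f : tm G (s ⇒ t)) (x y : tm G s),
    RCA0omega (eqt x y ⊃ eqt (f · x) (f · y))
| rca_ind : forall A : fm (O0 :: G), qf A -> RCA0omega (induction_for A)
| rca_QFAC10 : forall A : fm (O0 :: O1 :: G), qf A -> RCA0omega (choice_for A).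

(* [lam b] is the lambda-abstraction of [v0] in [b], by bracket abstraction. *)
Definition lam_var (G : ctx) (s t : ty) (x : var (s :: G) t) : tm G (s ⇒ t) :=
  vcase (P := fun t => tm G (s ⇒ t))
    (tSigma · tPi · (tPi (t := O0)))%tm (fun _ y => (tPi · tvar y)%tm) x.

Fixpoint lam (G : ctx) (s t : ty) (b : tm (s :: G) t) : tm G (s ⇒ t) :=
  match b with
  | tvar x => lam_var x
  | tapp f a => tSigma · lam f · lam a
  | tzero => tPi · 0
  | tone => tPi · 1
  | tplus => tPi · tplus
  | ttimes => tPi · ttimes
  | tPi => tPi · tPi
  | tSigma => tPi · tSigma
  | tRec => tPi · tRec
  end%tm.

Definition tpred (G : ctx) (a : tm G O0) : tm G O0 := (tRec · lam (lam v1) · 0 · a)%tm.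

Section Arithmetic.
Variable G : ctx.
Local Open Scope tm_scope.
Implicit Types a b c n : tm G O0.

(* [tsubn a b] is the truncated difference of [a] and [b]. *)
Definition tsubn a b : tm G O0 := tRec · lam (lam (tpred v0)) · a · b.
(* [tcond c a b] is [a] if [c] is 0 and [b] otherwise. *)
Definition tcond c a b : tm G O0 := tRec · (tPi · (tPi · b)) · a · c.
Definition texp2 n : tm G O0 := tRec · lam (lam (v0 + v0)) · 1 · n.
Definition ttri n : tm G O0 := tRec · lam (lam (v0 + (v1 + 1))) · 0 · n.

End Arithmetic.

Section Pairing.
Variable G : ctx.
Local Open Scope tm_scope.
Implicit Types a b c n : tm G O0.

(* Cantor's pairing function, a bijection between N x N and N.  [troot n] is
   the largest k with [ttri k <= n]. *)
Definition tpair a b : tm G O0 := ttri (a + b) + a.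
Definition troot n : tm G O0 :=
  tRec · lam (lam (tcond (tsubn (ttri (v0 + 1)) (v1 + 1)) (v0 + 1) v0)) · 0 · n.
Definition tfst n : tm G O0 := tsubn n (ttri (troot n)).
Definition tsnd n : tm G O0 := tsubn (troot n) (tfst n).

(* The code <u,<v,w>> stands for the rational (u - v) / (w + 1); hence every
    natural number codes a rational, and every rational has several codes. *)

Definition qmk u v w : tm G O0 := tpair u (tpair v w).
Definition qpos a : tm G O0 := tfst a.
Definition qneg a : tm G O0 := tfst (tsnd a).
Definition qden a : tm G O0 := tsnd (tsnd a) + 1.

Definition qadd a b : tm G O0 :=
  qmk (qpos a * qden b + qpos b * qden a) (qneg a * qden b + qneg b * qden a)
      (tpred (qden a * qden b)).
Definition qopp a : tm G O0 := qmk (qneg a) (qpos a) (tpred (qden a)).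
Definition qsub a b : tm G O0 := qadd a (qopp b).
Definition qabs a : tm G O0 :=
  qmk (tsubn (qpos a) (qneg a) + tsubn (qneg a) (qpos a)) 0 (tpred (qden a)).
Definition qzero : tm G O0 := qmk 0 0 0.
(* [qinv2 n] is 2^(-n) and [q2inv2 n] is 2^(-n+1). *)
Definition qinv2 n : tm G O0 := qmk 1 0 (tpred (texp2 n)).
Definition q2inv2 n : tm G O0 := qmk (1 + 1) 0 (tpred (texp2 n)).

Definition fle a b : fm G := a ≺ b ⋁ a ≡ b.
Definition qlt a b : fm G :=
  qpos a * qden b + qneg b * qden a ≺ qpos b * qden a + qneg a * qden b.
Definition qle a b : fm G :=
  fle (qpos a * qden b + qneg b * qden a) (qpos b * qden a + qneg a * qden b).

End Pairing.

Section Reals.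
Variable G : ctx.
Local Open Scope fm_scope.
Implicit Types x y : tm G O1.

Definition is_real x : fm G :=
  ∀[O0] ∀[O0] (* v1 = n, v0 = i *)
    qlt (qabs (qsub (↑↑x · v1) (↑↑x · (v1 + v0)))) (qinv2 v1).

Definition eqR x y : fm G :=
  ∀[O0] qle (qabs (qsub (↑x · v0) (↑y · v0))) (q2inv2 v0).

(* The negation of the usual y <= x, i.e. of: y_n <= x_n + 2^(-n+1) for all n. *)
Definition ltR x y : fm G :=
  ∃[O0] qlt (qadd (↑x · v0) (q2inv2 v0)) (↑y · v0).

(* The shift of the index makes the difference satisfy the modulus 2^(-n). *)
Definition subR x y : tm G O1 := lam (qsub (↑x · (v0 + 1)) (↑y · (v0 + 1))).
Definition absR x : tm G O1 := lam (qabs (↑x · v0)).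
Definition ratR (q : tm G O0) : tm G O1 := tPi · q.
Definition zeroR : tm G O1 := ratR qzero.

End Reals.

Section Sets.
Variable G : ctx.
Local Open Scope fm_scope.

Definition real_function (f : tm G (O1 ⇒ O1)) : fm G :=
  (∀[O1] is_real v0 ⊃ is_real (↑f · v0))
  ⋀ (∀[O1] ∀[O1] is_real v1 ⊃ is_real v0 ⊃ eqR v1 v0
       ⊃ eqR (↑↑f · v1) (↑↑f · v0)).

Definition mem (x : tm G O1) (F : tm G (O1 ⇒ O1)) : fm G :=
  ltR zeroR (absR (F · x)).

Definition in_ball (y x : tm G O1) (r : tm G O0) : fm G :=
  ltR (absR (subR x y)) (ratR r).

End Sets.

(* The set of the reals [v0] satisfying [U] is open.  The renaming yields U(y)
   in the scope of the quantifiers on x, r and y. *)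
Definition is_open (G : ctx) (U : fm (O1 :: G)) : fm G :=
 (∀[O1] (* x *) is_real v0 ⊃ U ⊃
    ∃[O0] (* r *) qlt qzero v0 ⋀
      ∀[O1] (* y *) is_real v0 ⊃ in_ball v0 v2 v1
        ⊃ fren (rup (fun _ z => vs (vs z))) U)%fm.

Definition compl (G : ctx) (F : tm G (O1 ⇒ O1)) : fm (O1 :: G) := (∼ mem v0 (↑F))%fm.
Definition is_closed (G : ctx) (F : tm G (O1 ⇒ O1)) : fm G := is_open (compl F).

(* An index set is given by [D] of type 2 and a relation on it by [P] of type
    (1 x 1) -> 0, here curried. *)

Section Index.
Variable G : ctx.
Local Open Scope fm_scope.

Definition in_idx (d : tm G O1) (D : tm G (O1 ⇒ O0)) : fm G := D · d ≡ 1.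
Definition preceq (P : tm G (O1 ⇒ O1 ⇒ O0)) (d e : tm G O1) : fm G := P · d · e ≡ 1.

End Index.

Section Nets.
Variable G : ctx.
Local Open Scope fm_scope.
Variables (D : tm G (O1 ⇒ O0)) (P : tm G (O1 ⇒ O1 ⇒ O0)).

Definition characteristic : fm G :=
  (∀[O1] fle (↑D · v0) 1) ⋀ (∀[O1] ∀[O1] fle (↑↑P · v1 · v0) 1).

Definition directed : fm G :=
  (∃[O1] in_idx v0 (↑D))
  ⋀ (∀[O1] in_idx v0 (↑D) ⊃ preceq (↑P) v0 v0)
  ⋀ (∀[O1] ∀[O1] ∀[O1]
       in_idx v2 (↑↑↑D) ⊃ in_idx v1 (↑↑↑D) ⊃ in_idx v0 (↑↑↑D)
       ⊃ preceq (↑↑↑P) v2 v1 ⊃ preceq (↑↑↑P) v1 v0 ⊃ preceq (↑↑↑P) v2 v0)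
  ⋀ (∀[O1] ∀[O1] in_idx v1 (↑↑D) ⊃ in_idx v0 (↑↑D)
       ⊃ ∃[O1] in_idx v0 (↑↑↑D)
           ⋀ preceq (↑↑↑P) v2 v0 ⋀ preceq (↑↑↑P) v1 v0).

Definition is_net (X : tm G (O1 ⇒ O1)) : fm G :=
  characteristic ⋀ directed ⋀ (∀[O1] in_idx v0 (↑D) ⊃ is_real (↑X · v0)).

Definition converges (X : tm G (O1 ⇒ O1)) (x : tm G O1) : fm G :=
  ∀[O1] (* ε *) is_real v0 ⊃ ltR zeroR v0 ⊃
    ∃[O1] (* d0 *) in_idx v0 (↑↑D) ⋀
      ∀[O1] (* e *) in_idx v0 (↑↑↑D) ⊃ preceq (↑↑↑P) v1 v0
        ⊃ ltR (absR (subR (↑↑↑X · v0) (↑↑↑x))) v2.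

End Nets.

Definition net_closed (G : ctx) (F : tm G (O1 ⇒ O1)) : fm G :=
  ∀[O1 ⇒ O0] ∀[O1 ⇒ O1 ⇒ O0] ∀[O1 ⇒ O1] ∀[O1]
    (* v3 = D, v2 = ⪯, v1 = (x_d), v0 = x *)
    is_net v3 v2 v1 ⊃ is_real v0
    ⊃ (∀[O1] in_idx v0 (↑v3) ⊃ mem (↑v1 · v0) (↑↑↑↑↑F))
      ⋀ converges v3 v2 v1 v0
    ⊃ mem v0 (↑↑↑↑F).

(* Main.v *)
(** By a Henkin construction it is enough to argue in an arbitrary extensional structure satisfying
    RCA_0^omega.  Suppose [x] is adherent to [F] there.  "The real [y] lies in [F] and within
    [4 * 2^-n] of [x]" is not decidable, but it becomes quantifier-free once [y] is given together
    with a witness [w] of [|F y| > 0] and every sequence is made to code a real by ignoring updates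
    that break the modulus.  Hence the triples [(n, w, y)] with this property form an index set
    with a characteristic function definable by a term, and ordering them by [n] gives a net
    [(n, w, y) |-> y] in [F] converging to [x]; net-closedness puts [x] in [F]. *)

From Stdlib Require Import List Arith Lia Cantor RelationClasses Ring.
From Stdlib Require Import FunctionalExtensionality PropExtensionality ClassicalEpsilon.
Require Import Defs.
Import ListNotations.

Set Implicit Arguments.
Unset Strict Implicit.
Unset Printing Implicit Defensive.

(** * Substitution *)

(** The natural attempt picks one point of [F] for each precision [n] and uses a sequence. That is a
    choice of type 1 objects, an instance of QF-AC^{0,1}, which is not among the axioms. A net
    admits all candidate points at once, so nothing is chosen. The obstacle moves to the index set,
    which a term must decide, whereas being a real is a universal statement and lying in [F] or near
    [x] an existential one. Closeness is therefore tested only on the [n]-th rational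
    approximations, and this inaccuracy is what the factor 4 absorbs. The semantic detour pays
    because in an extensional structure the equations of the system become identities that can be
    rewritten with, and the coded rationals have an actual quotient ring. The price is that the
    domain of type 0 may be nonstandard, so each induction on numbers has to go through a
    quantifier-free formula of the language. *)

Lemma var_cons_ind (G : ctx) (s : ty) (P : forall t, var (s :: G) t -> Prop) :
  P s vz -> (forall t (x : var G t), P t (vs x)) -> forall t (x : var (s :: G) t), P t x.
Proof.
intros Hz Hs t x.
(* The return type is computed from the context [G'], so no equation between contexts arises; [P] is
   quantified again inside because its type depends on that context. *)
exact (match x as x0 in var G' t' return
         match G' return var G' t' -> Prop with
         | [] => fun _ => True
         | s' :: G'' => fun x =>
             forall P : (forall t, var (s' :: G'') t -> Prop), P s' vz ->
               (forall t (y : var G'' t), P t (vs y)) -> P t' x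
         end x0
       with
       | vz => fun P Hz _ => Hz
       | vs y => fun P _ Hs => Hs _ y
       end P Hz Hs).
Qed.

Lemma vcase_ext (P : ty -> Type) (G : ctx) (s : ty) (z : P s)
    (f : forall t, var G t -> P t) (g : forall t, var (s :: G) t -> P t) :
  g s vz = z -> (forall t x, g t (vs x) = f t x) -> vcase z f = g.
Proof.
intros Hz Hs. extensionality t. extensionality x. revert t x.
apply var_cons_ind; simpl; auto.
Qed.

Lemma tren_tren (G D E : ctx) (r : ren G D) (q : ren D E) (s : ty) (a : tm G s) :
  tren q (tren r a) = tren (fun s x => q s (r s x)) a.
Proof. induction a; simpl; congruence. Qed.

Lemma tren_tsub (G D E : ctx) (r : sub G D) (q : ren D E) (s : ty) (a : tm G s) :
  tren q (tsub r a) = tsub (fun s x => tren q (r s x)) a.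
Proof. induction a; simpl; congruence. Qed.

Lemma tsub_tren (G D E : ctx) (r : ren G D) (q : sub D E) (s : ty) (a : tm G s) :
  tsub q (tren r a) = tsub (fun s x => q s (r s x)) a.
Proof. induction a; simpl; congruence. Qed.

Lemma tsub_sup_twk (G D : ctx) (t : ty) (r : sub G D) (s : ty) (a : tm G s) :
  tsub (sup (s := t) r) (twk (t := t) a) = twk (tsub r a).
Proof. unfold twk. rewrite tsub_tren, tren_tsub. reflexivity. Qed.

Lemma tsub_tsub (G D E : ctx) (r : sub G D) (q : sub D E) (s : ty) (a : tm G s) :
  tsub q (tsub r a) = tsub (fun s x => tsub q (r s x)) a.
Proof. induction a; simpl; congruence. Qed.

Lemma sup_sup (G D E : ctx) (t : ty) (r : sub G D) (q : sub D E) :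
  (fun s x => tsub (sup (s := t) q) (sup (s := t) r x)) = sup (fun s x => tsub q (r s x)).
Proof.
symmetry; apply vcase_ext; [reflexivity|].
intros u x; simpl. apply tsub_sup_twk.
Qed.

Lemma sup_tvar (G D : ctx) (t : ty) (r : ren G D) :
  sup (s := t) (fun s x => tvar (r s x)) = fun s x => tvar (rup r x).
Proof. apply vcase_ext; reflexivity. Qed.

Lemma sup_id (G : ctx) (t : ty) : sup (s := t) (fun s (x : var G s) => tvar x) = fun s x => tvar x.
Proof. apply vcase_ext; reflexivity. Qed.

Lemma tsub_id (G : ctx) (s : ty) (a : tm G s) : tsub (fun s x => tvar x) a = a.
Proof. induction a; simpl; congruence. Qed.

Lemma fsub_id (G : ctx) (A : fm G) : fsub (fun s x => tvar x) A = A.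
Proof.
induction A; simpl; rewrite ?tsub_id; try congruence; f_equal; now rewrite sup_id.
Qed.

Lemma tren_as_tsub (G D : ctx) (r : ren G D) (s : ty) (a : tm G s) :
  tren r a = tsub (fun s x => tvar (r s x)) a.
Proof. induction a; simpl; congruence. Qed.

(** Treating renamings as substitutions lets the composition law [fsub_fsub] serve for weakening of
    formulas as well. *)
Lemma fren_as_fsub (G D : ctx) (r : ren G D) (A : fm G) :
  fren r A = fsub (fun s x => tvar (r s x)) A.
Proof.
revert D r; induction A as [G a b|G a b|G|G A IHA B IHB|G A IHA B IHB|G A IHA B IHB|G s A IH|G s A IH];
  intros D r; simpl; rewrite ?tren_as_tsub, ?IHA, ?IHB; try reflexivity;
  rewrite IH; do 2 f_equal; symmetry; apply sup_tvar.
Qed.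

Lemma fsub_fsub (G D E : ctx) (r : sub G D) (q : sub D E) (A : fm G) :
  fsub q (fsub r A) = fsub (fun s x => tsub q (r s x)) A.
Proof.
revert D E r q; induction A as [G a b|G a b|G|G A IHA B IHB|G A IHA B IHB|G A IHA B IHB|G s A IH|G s A IH];
  intros D E r q; simpl; rewrite ?tsub_tsub, ?IHA, ?IHB; try reflexivity;
  now rewrite IH, sup_sup.
Qed.

Lemma fsub_fwk (G D : ctx) (t : ty) (r : sub (t :: G) D) (A : fm G) :
  fsub r (fwk (t := t) A) = fsub (fun s x => r s (vs x)) A.
Proof. unfold fwk. rewrite fren_as_fsub, fsub_fsub. reflexivity. Qed.

Lemma fwk_fsub (G D : ctx) (t : ty) (r : sub G D) (A : fm G) :
  fwk (t := t) (fsub r A) = fsub (fun s x => twk (r s x)) A.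
Proof.
unfold fwk. rewrite fren_as_fsub, fsub_fsub. f_equal.
extensionality s; extensionality x. unfold twk. now rewrite tren_as_tsub.
Qed.

Lemma fsub_sup_fwk (G D : ctx) (t : ty) (r : sub G D) (A : fm G) :
  fsub (sup (s := t) r) (fwk (t := t) A) = fwk (fsub r A).
Proof. now rewrite fsub_fwk, fwk_fsub. Qed.

Lemma tsub_scons_twk (G D : ctx) (t s : ty) (c : tm D t) (r : sub G D) (a : tm G s) :
  tsub (scons c r) (twk a) = tsub r a.
Proof. unfold twk. now rewrite tsub_tren. Qed.

Lemma fsub_scons_sup (G D E : ctx) (t : ty) (r : sub G D) (q : sub D E) (a : tm E t)
    (A : fm (t :: G)) :
  fsub (scons a q) (fsub (sup r) A) = fsub (scons a (fun s x => tsub q (r s x))) A.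
Proof.
rewrite fsub_fsub; f_equal. symmetry; apply vcase_ext; [reflexivity|].
intros u x; simpl. apply tsub_scons_twk.
Qed.

Lemma finst_fsub_sup (G D : ctx) (t : ty) (r : sub G D) (a : tm D t) (A : fm (t :: G)) :
  finst (fsub (sup r) A) a = fsub (scons a r) A.
Proof.
unfold finst. rewrite fsub_scons_sup. do 2 f_equal.
extensionality s; extensionality x. apply tsub_id.
Qed.

Lemma fsub_finst (G D : ctx) (t : ty) (r : sub G D) (a : tm G t) (A : fm (t :: G)) :
  fsub r (finst A a) = finst (fsub (sup r) A) (tsub r a).
Proof.
rewrite finst_fsub_sup. unfold finst. rewrite fsub_fsub. f_equal.
symmetry; apply vcase_ext; reflexivity.
Qed.

Lemma fsub_eqt (s : ty) (G D : ctx) (r : sub G D) (a b : tm G s) :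
  fsub r (eqt a b) = eqt (tsub r a) (tsub r b).
Proof.
revert G D r a b; induction s as [|s _ t IH]; intros G D r a b; [reflexivity|].
cbn [eqt fsub]. rewrite IH. cbn [tsub]. now rewrite !tsub_sup_twk.
Qed.

(** * Derivations *)

Definition sub_closed (T : theory) : Prop :=
  forall (G D : ctx) (r : sub G D) (A : fm G), T G A -> T D (fsub r A).

(** Substitution and weakening are proved in one induction: [H'] only has to contain the substituted
    hypotheses, so the identity substitution yields monotonicity, and the same lemma moves
    derivations between the stages of the Henkin construction. *)
Lemma prf_sub (T : theory) (G D : ctx) (r : sub G D) (H : list (fm G)) (H' : list (fm D)) (A : fm G) :
  sub_closed T -> prf T H A -> (forall B, In B H -> In (fsub r B) H') -> prf T H' (fsub r A).
Proof.
intros HT p. revert D r H'.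
induction p as [G H A HA|G H A HA|G H A B _ IH|G H A B _ IH1 _ IH2|G H A B _ IH1 _ IH2
  |G H A B _ IH|G H A B _ IH|G H A B _ IH|G H A B _ IH|G H A B C _ IH _ IH1 _ IH2
  |G H A _ IH|G H A _ IH|G H s A _ IH|G H s A a _ IH|G H s A a _ IH|G H s A C _ IH1 _ IH2
  |G H a|G H A a b _ IH1 _ IH2]; intros D r H' HH; simpl.
- now apply prf_ax, HT.
- now apply prf_hyp, HH.
- apply prf_impI, IH. intros C [<-|HC]; [left|right]; auto.
- eapply prf_impE; [apply IH1|apply IH2]; auto.
- apply prf_andI; auto.
- eapply prf_andE1, IH; auto.
- eapply prf_andE2, IH; auto.
- apply prf_orI1; auto.
- apply prf_orI2; auto.
- eapply prf_orE; [now apply (IH _ r)|apply (IH1 _ r)|apply (IH2 _ r)];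
    intros E [<-|HE]; ((now left) || (right; auto)).
- apply prf_botE; auto. apply (IH _ r); auto.
- apply prf_dne. apply (IH _ r); auto.
- apply prf_allI, IH. intros B HB. apply in_map_iff in HB as [C [<- HC]].
  rewrite fsub_sup_fwk. apply in_map; auto.
- rewrite fsub_finst. apply prf_allE. apply (IH _ r); auto.
- eapply prf_exI with (a := tsub r a). rewrite <- fsub_finst. auto.
- eapply prf_exE; [apply (IH1 _ r); auto|].
  rewrite <- fsub_sup_fwk. apply IH2. intros B [<-|HB]; [now left|right].
  apply in_map_iff in HB as [E [<- HE]]. rewrite fsub_sup_fwk. apply in_map; auto.
- apply prf_refl.
- rewrite fsub_finst. eapply prf_leibniz; [now apply (IH1 _ r)|].
  rewrite <- fsub_finst. auto.
Qed.

Lemma prf_mono (T : theory) (G : ctx) (H H' : list (fm G)) (A : fm G) :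
  sub_closed T -> prf T H A -> incl H H' -> prf T H' A.
Proof.
intros HT p Hi. rewrite <- (fsub_id A). apply (prf_sub HT p).
intros B HB. rewrite fsub_id. auto.
Qed.

Lemma prf_hyp0 (T : theory) (G : ctx) (H : list (fm G)) (A : fm G) : prf T (A :: H) A.
Proof. apply prf_hyp; now left. Qed.

Lemma prf_eq_sym (T : theory) (G : ctx) (H : list (fm G)) (a b : tm G O0) :
  prf T H (a ≡ b)%fm -> prf T H (b ≡ a)%fm.
Proof.
intros p. pose proof (prf_leibniz (A := (v0 ≡ ↑a)%fm) p) as L.
unfold finst in L; cbn in L. rewrite !tsub_scons_twk, !tsub_id in L. apply L, prf_refl.
Qed.

Lemma prf_eq_trans (T : theory) (G : ctx) (H : list (fm G)) (a b c : tm G O0) :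
  prf T H (a ≡ b)%fm -> prf T H (b ≡ c)%fm -> prf T H (a ≡ c)%fm.
Proof.
intros p q. pose proof (prf_leibniz (A := (↑a ≡ v0)%fm) q) as L.
unfold finst in L; cbn in L. rewrite !tsub_scons_twk, !tsub_id in L. now apply L.
Qed.
(** * Structures *)

(** A Henkin structure: the elements of an arrow domain need not be functions, and need not realise
    all functions between the domains. *)
Record structure : Type := Structure {
  dom : ty -> Type;
  app : forall s t, dom (s ⇒ t)%ty -> dom s -> dom t;
  zero : dom O0;
  one : dom O0;
  plus : dom (O0 ⇒ O0 ⇒ O0)%ty;
  times : dom (O0 ⇒ O0 ⇒ O0)%ty;
  Pi : forall s t, dom (s ⇒ t ⇒ s)%ty;
  Sigma : forall r s t, dom ((r ⇒ s ⇒ t) ⇒ (r ⇒ s) ⇒ r ⇒ t)%ty;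
  Rec : dom ((O0 ⇒ O0 ⇒ O0) ⇒ O0 ⇒ O0 ⇒ O0)%ty;
  lt : dom O0 -> dom O0 -> Prop }.

Definition env (M : structure) (G : ctx) : Type := forall s, var G s -> dom M s.

Definition econs (M : structure) (G : ctx) (s : ty) (d : dom M s) (e : env M G) : env M (s :: G) :=
  vcase d e.

Definition enil (M : structure) : env M [] := fun s x => match x with end.

Fixpoint eval (M : structure) (G : ctx) (e : env M G) (s : ty) (a : tm G s) : dom M s :=
  match a with
  | tvar x => e _ x
  | tapp f b => app (eval e f) (eval e b)
  | tzero => zero M
  | tone => one M
  | tplus => plus M
  | ttimes => times M
  | tPi => Pi M _ _
  | tSigma => Sigma M _ _ _
  | tRec => Rec M
  end.

(** Equality at type 0 is interpreted as identity; this is why the term model below has to be a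
    quotient. *)
Fixpoint sat (M : structure) (G : ctx) (e : env M G) (A : fm G) : Prop :=
  match A with
  | feq a b => eval e a = eval e b
  | flt a b => lt (eval e a) (eval e b)
  | fbot => False
  | fimp A B => sat e A -> sat e B
  | fand A B => sat e A /\ sat e B
  | for_ A B => sat e A \/ sat e B
  | fall A => forall d, sat (econs d e) A
  | fex A => exists d, sat (econs d e) A
  end.

Definition extensional (M : structure) : Prop :=
  forall s t (f g : dom M (s ⇒ t)%ty), (forall x, app f x = app g x) -> f = g.

Definition models (M : structure) (T : theory) : Prop :=
  forall (G : ctx) (A : fm G) (e : env M G), T G A -> sat e A.

(** * Enumerations and quotients *)

Lemma ty_eq_dec (s t : ty) : {s = t} + {s <> t}.
Proof. decide equality. Defined.

Fixpoint code_ty (s : ty) : nat :=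
  match s with
  | nat0 => 0
  | arr s t => S (to_nat (code_ty s, code_ty t))
  end.

Fixpoint code_var (G : ctx) (s : ty) (x : var G s) : nat :=
  match x with
  | vz => 0
  | vs y => S (code_var y)
  end.

Fixpoint code_tm (G : ctx) (s : ty) (a : tm G s) : nat :=
  match a with
  | tvar x => to_nat (0, code_var x)
  | tapp f b => to_nat (1, to_nat (code_tm f, code_tm b))
  | tzero => to_nat (2, 0)
  | tone => to_nat (3, 0)
  | tplus => to_nat (4, 0)
  | ttimes => to_nat (5, 0)
  | @tPi _ s t => to_nat (6, to_nat (code_ty s, code_ty t))
  | @tSigma _ r s t => to_nat (7, to_nat (code_ty r, to_nat (code_ty s, code_ty t)))
  | tRec => to_nat (8, 0)
  end.

Fixpoint code_fm (G : ctx) (A : fm G) : nat :=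
  match A with
  | feq a b => to_nat (0, to_nat (code_tm a, code_tm b))
  | flt a b => to_nat (1, to_nat (code_tm a, code_tm b))
  | fbot => to_nat (2, 0)
  | fimp A B => to_nat (3, to_nat (code_fm A, code_fm B))
  | fand A B => to_nat (4, to_nat (code_fm A, code_fm B))
  | for_ A B => to_nat (5, to_nat (code_fm A, code_fm B))
  | @fall _ s A => to_nat (6, to_nat (code_ty s, code_fm A))
  | @fex _ s A => to_nat (7, to_nat (code_ty s, code_fm A))
  end.

Lemma to_nat_split (a b c d : nat) : to_nat (a, b) = to_nat (c, d) -> a = c /\ b = d.
Proof. intros E. apply to_nat_inj in E. now injection E. Qed.

Ltac split_codes :=
  repeat match goal with
  | E : to_nat _ = to_nat _ |- _ => apply to_nat_split in E as [? ?]
  end.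

Ltac split_sigma E :=
  let E' := fresh in
  pose proof (f_equal (@projT1 _ _) E) as E'; simpl in E'; try injection E'; intros; subst;
  apply inj_pair2 in E; subst.

Lemma code_ty_inj (s t : ty) : code_ty s = code_ty t -> s = t.
Proof.
revert t; induction s as [|s IHs s' IHs']; intros [|t t'] E; try discriminate; [reflexivity|].
cbn [code_ty] in E. apply Nat.succ_inj in E. split_codes. f_equal; auto.
Qed.

Lemma code_var_inj (G : ctx) (s t : ty) (x : var G s) (y : var G t) :
  code_var x = code_var y -> existT (var G) s x = existT (var G) t y.
Proof.
revert t y; induction x as [G s|G s u x IH].
- intros t y; revert t y.
  refine (var_cons_ind (P := fun t y => code_var vz = code_var y ->
    existT (var (s :: G)) s vz = existT (var (s :: G)) t y) _ _); [reflexivity|discriminate].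
- intros t y; revert t y.
  refine (var_cons_ind (P := fun t y => code_var (vs x) = code_var y ->
    existT (var (u :: G)) s (vs x) = existT (var (u :: G)) t y) _ _); [discriminate|].
  intros t y E. injection E as E. specialize (IH _ _ E).
  now split_sigma IH.
Qed.

(** An application hides the type of its argument, so the induction has to compare terms of possibly
    different types; hence the equality of dependent pairs. *)
Lemma code_tm_inj (G : ctx) (s t : ty) (a : tm G s) (b : tm G t) :
  code_tm a = code_tm b -> existT (tm G) s a = existT (tm G) t b.
Proof.
revert t b; induction a as [s x|s s' f IHf a IHa| | | | |s t|r s t|];
  intros u [s0 y|s0 s0' f0 a0| | | | |s0 t0|r0 s0 t0|] E; cbn [code_tm] in E; split_codes;
  try discriminate; try reflexivity.
- match goal with E : code_var _ = _ |- _ => apply code_var_inj in E; now split_sigma E end.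
- match goal with
  | E1 : code_tm f = _, E2 : code_tm a = _ |- _ =>
      apply IHf in E1; apply IHa in E2; split_sigma E1; now split_sigma E2
  end.
- repeat match goal with E : code_ty _ = _ |- _ => apply code_ty_inj in E end. now subst.
- repeat match goal with E : code_ty _ = _ |- _ => apply code_ty_inj in E end. now subst.
Qed.

Lemma code_tm_inj' (G : ctx) (s : ty) (a b : tm G s) : code_tm a = code_tm b -> a = b.
Proof. intros E. now apply code_tm_inj, inj_pair2 in E. Qed.

Lemma code_fm_inj (G : ctx) (A B : fm G) : code_fm A = code_fm B -> A = B.
Proof.
revert B; induction A as [G a b|G a b|G|G A IHA B IHB|G A IHA B IHB|G A IHA B IHB|G s A IH|G s A IH];
  intros B0 E; destruct B0; cbn [code_fm] in E; split_codes; try discriminate; try reflexivity;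
  try (f_equal; auto using code_tm_inj'; fail).
all: match goal with E : code_ty _ = _ |- _ => apply code_ty_inj in E; subst end; f_equal; auto.
Qed.

Definition decode (X : Type) (x0 : X) (code : X -> nat) (n : nat) : X :=
  epsilon (inhabits x0) (fun x => code x = n).

Lemma codeK (X : Type) (x0 : X) (code : X -> nat) :
  (forall x y, code x = code y -> x = y) -> forall x, decode x0 code (code x) = x.
Proof. intros Hi x. apply Hi. apply (epsilon_spec (inhabits x0) (fun y => code y = code x)). now exists x. Qed.

Definition quot (X : Type) (R : X -> X -> Prop) : Type := {P : X -> Prop | exists x, P = R x}.

Definition cls (X : Type) (R : X -> X -> Prop) (x : X) : quot R :=
  exist _ (R x) (ex_intro _ x eq_refl).

Lemma cls_surj (X : Type) (R : X -> X -> Prop) (q : quot R) : exists x, q = cls R x.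
Proof. destruct q as [P [x ->]]. now exists x. Qed.

Lemma cls_eq (X : Type) (R : X -> X -> Prop) (HR : Equivalence R) (x y : X) :
  cls R x = cls R y <-> R x y.
Proof.
split; intros E.
- assert (E' : R x y = R y y) by exact (f_equal (fun q => proj1_sig q y) E).
  rewrite E'. reflexivity.
- apply eq_sig_hprop; [intros; apply proof_irrelevance|simpl].
  extensionality z. apply propositional_extensionality. now rewrite E.
Qed.

Definition rep (X : Type) (R : X -> X -> Prop) (q : quot R) : X :=
  proj1_sig (constructive_indefinite_description _ (cls_surj q)).

Lemma cls_rep (X : Type) (R : X -> X -> Prop) (q : quot R) : cls R (rep q) = q.
Proof. symmetry. exact (proj2_sig (constructive_indefinite_description _ (cls_surj q))). Qed.

(** * Completeness *)

(** Every type has a closed inhabitant, so a variable can be discharged by instantiation. *)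
Fixpoint tdefault (s : ty) (G : ctx) : tm G s :=
  match s with
  | nat0 => tzero
  | arr s t => (tPi · tdefault t G)%tm
  end.

(** The Henkin axiom for the newest variable. The type of that variable is chosen independently of
    the formula, so the two types may disagree, and then nothing is added. *)
Definition witness (t : ty) (G : ctx) (A : fm G) : list (fm (t :: G)) :=
  match A with
  | @fex _ s B =>
      match ty_eq_dec s t with
      | left e => [eq_rect s (fun s => fm (s :: G)) B t e]
      | right _ => []
      end
  | _ => []
  end.

Lemma witness_fex (t : ty) (G : ctx) (A : fm (t :: G)) : witness t (fex A) = [A].
Proof.
simpl. destruct (ty_eq_dec t t) as [e|n]; [|now destruct n].
now rewrite (UIP_refl _ _ e).
Qed.

Section Henkin.

Variables (T : theory) (A0 : fm []).
Hypothesis T_sub : sub_closed T.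
Hypothesis T_ext : forall G s t (f : tm G (s ⇒ t)%ty) (x y : tm G s),
  T (eqt x y ⊃ eqt (f · x) (f · y))%fm.
Hypothesis A0_unprovable : ~ provable T A0.

Definition consistent (G : ctx) (H : list (fm G)) : Prop := ~ prf T H ⊥%fm.

(** A derivation of falsity that mentions the new variable can be generalised over it and
    instantiated with a default term. *)
Lemma consistent_fwk (t : ty) (G : ctx) (H : list (fm G)) :
  consistent H -> consistent (map (@fwk G t) H).
Proof.
intros c p. apply c. exact (prf_allE (A := ⊥%fm) (a := tdefault t G) (prf_allI p)).
Qed.

Lemma consistent_witness (t : ty) (G : ctx) (H : list (fm G)) (A : fm G) :
  consistent (A :: H) -> consistent (witness t A ++ map (@fwk G t) (A :: H)).
Proof.
intros c. destruct A; try exact (consistent_fwk c).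
cbn [witness]. destruct (ty_eq_dec s t) as [<-|n]; [|exact (consistent_fwk c)].
intros p. apply c. exact (prf_exE (C := ⊥%fm) (prf_hyp0 _ _ _) p).
Qed.

(* Step [to_nat (m, to_nat (k, j))] treats the [k]-th formula of stage [m] and
   declares a new variable of the [j]-th type, a possible Henkin witness. *)
Definition new_ty (n : nat) : ty := decode O0 code_ty (snd (of_nat (snd (of_nat n)))).

Fixpoint stage (n : nat) : ctx :=
  match n with
  | 0 => []
  | S n => new_ty n :: stage n
  end.

Definition cast_sub (n m : nat) (e : n = m) : sub (stage n) (stage m) :=
  match e with eq_refl => fun s x => tvar x end.

(* Only meaningful for [n <= m]: for [n > m] the variables are sent to default terms. *)
Fixpoint up (n m : nat) {struct m} : sub (stage n) (stage m) :=
  match m with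
  | 0 =>
      match Nat.eq_dec n 0 with
      | left e => cast_sub e
      | right _ => fun s x => tdefault s _
      end
  | S m' =>
      match Nat.eq_dec n (S m') with
      | left e => cast_sub e
      | right _ => fun s x => twk (@up n m' s x)
      end
  end.
Arguments up n m [s] x.

Lemma up_refl (n : nat) : up n n = fun s x => tvar x.
Proof.
destruct n; cbn [up]; destruct Nat.eq_dec as [e|ne]; try now destruct ne.
- now rewrite (UIP_refl _ _ e).
- now rewrite (UIP_refl _ _ e).
Qed.

Lemma up_S (n m : nat) : n <= m -> up n (S m) = fun s x => twk (up n m x).
Proof. intros h. cbn [up]. destruct Nat.eq_dec; [lia|reflexivity]. Qed.

Lemma fsub_up_S (n m : nat) (A : fm (stage n)) :
  n <= m -> fsub (up n (S m)) A = fwk (t := new_ty m) (fsub (up n m) A).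
Proof. intros h. now rewrite (up_S h), fwk_fsub. Qed.

Lemma tsub_up (n m p : nat) (s : ty) (a : tm (stage n) s) :
  n <= m -> m <= p -> tsub (up m p) (tsub (up n m) a) = tsub (up n p) a.
Proof.
intros h1 h2. induction h2 as [|p h2 IH].
- now rewrite up_refl, tsub_id.
- rewrite !up_S by lia. rewrite !tsub_tsub in *.
  transitivity (twk (t := new_ty p) (tsub (up n p) a)).
  + rewrite <- IH. unfold twk. rewrite tren_tsub. f_equal.
    extensionality u; extensionality x. now rewrite tren_tsub.
  + unfold twk. now rewrite tren_tsub.
Qed.

Lemma fsub_up (n m p : nat) (A : fm (stage n)) :
  n <= m -> m <= p -> fsub (up m p) (fsub (up n m) A) = fsub (up n p) A.
Proof.
intros h1 h2. rewrite fsub_fsub. f_equal. extensionality s; extensionality x.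
exact (tsub_up (tvar x) h1 h2).
Qed.

Definition item (n : nat) : fm (stage n) :=
  fsub (up (fst (of_nat n)) n) (decode ⊥%fm (@code_fm _) (fst (of_nat (snd (of_nat n))))).

(** The Lindenbaum extension and the Henkin witnesses are interleaved: an accepted formula enters
    together with its witness. *)
Definition next_hyps (n : nat) (H : list (fm (stage n))) : list (fm (stage (S n))) :=
  if excluded_middle_informative (consistent (item n :: H))
  then witness (new_ty n) (item n) ++ map (@fwk _ _) (item n :: H)
  else map (@fwk _ _) H.

Fixpoint hyps (n : nat) : list (fm (stage n)) :=
  match n with
  | 0 => [(∼ A0)%fm]
  | S n => next_hyps (hyps n)
  end.

Lemma hyps_consistent (n : nat) : consistent (hyps n).
Proof.
induction n as [|n IH]; cbn [hyps].
- intros p. apply A0_unprovable, prf_dne, prf_impI, p.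
- unfold next_hyps. destruct excluded_middle_informative as [c|c].
  + now apply consistent_witness.
  + now apply consistent_fwk.
Qed.

Lemma hyps_up (n m : nat) (A : fm (stage n)) :
  n <= m -> In A (hyps n) -> In (fsub (up n m) A) (hyps m).
Proof.
intros h HA. induction h as [|m h IH].
- now rewrite up_refl, fsub_id.
- rewrite fsub_up_S by assumption. cbn [hyps]. unfold next_hyps.
  destruct excluded_middle_informative as [_|_].
  + apply in_or_app; right; right. now apply in_map.
  + now apply in_map.
Qed.

Lemma prf_hyps_up (n m : nat) (A : fm (stage n)) :
  n <= m -> prf T (hyps n) A -> prf T (hyps m) (fsub (up n m) A).
Proof. intros h p. apply (prf_sub T_sub p). intros B. now apply hyps_up. Qed.

(** Membership in the limit theory. Contexts grow along the stages, so the formula is moved to the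
    stage at which it is derived. *)
Definition holds (n : nat) (A : fm (stage n)) : Prop :=
  exists m, n <= m /\ prf T (hyps m) (fsub (up n m) A).

Lemma holds_from (n m : nat) (A : fm (stage n)) :
  n <= m -> prf T (hyps m) (fsub (up n m) A) ->
  forall p, m <= p -> prf T (hyps p) (fsub (up n p) A).
Proof. intros h p q hq. rewrite <- (fsub_up A h hq). now apply prf_hyps_up. Qed.

Lemma holds_up (n m : nat) (A : fm (stage n)) :
  n <= m -> holds A <-> holds (fsub (up n m) A).
Proof.
intros h; split; intros [p [hp q]].
- exists (max m p). split; [lia|]. rewrite fsub_up by lia. apply (holds_from hp q); lia.
- exists p. split; [lia|]. now rewrite fsub_up in q by lia.
Qed.

Lemma prf_cut_list (G : ctx) (L H : list (fm G)) (A : fm G) :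
  prf T L A -> (forall B, In B L -> prf T H B) -> prf T H A.
Proof.
revert A; induction L as [|C L IH]; intros A p HL.
- apply (prf_mono T_sub p). intros B [].
- apply prf_impE with C; [|apply HL; now left].
  apply IH; [now apply prf_impI|]. intros B HB. apply HL. now right.
Qed.

(** A derivation has finitely many premises, and these are all provable at one sufficiently late
    stage. *)
Lemma holds_entail (n : nat) (L : list (fm (stage n))) (A : fm (stage n)) :
  prf T L A -> (forall B, In B L -> holds B) -> holds A.
Proof.
intros p HL.
assert (Hm : exists m, n <= m /\ forall B, In B L -> prf T (hyps m) (fsub (up n m) B)).
{ clear p. induction L as [|C L IH].
  - exists n. split; [lia|]. intros B [].
  - destruct IH as [m [hm Hm]]; [intros B HB; apply HL; now right|].
    destruct (HL C) as [k [hk Hk]]; [now left|].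
    exists (max m k). split; [lia|]. intros B [<-|HB].
    + apply (holds_from hk Hk); lia.
    + apply (holds_from hm (Hm B HB)); lia. }
destruct Hm as [m [hm Hm]]. exists m. split; [assumption|].
apply prf_cut_list with (map (fsub (up n m)) L).
- apply (prf_sub T_sub p). intros B. apply in_map.
- intros B HB. apply in_map_iff in HB as [C [<- HC]]. auto.
Qed.

Lemma holds_prf (n : nat) (A : fm (stage n)) : prf T [] A -> holds A.
Proof. intros p. apply (holds_entail p). intros B []. Qed.

Lemma holds_entail1 (n : nat) (A B : fm (stage n)) : prf T [A] B -> holds A -> holds B.
Proof. intros p HA. apply (holds_entail p). now intros C [<-|[]]. Qed.

Lemma holds_entail2 (n : nat) (A B C : fm (stage n)) :
  prf T [A; B] C -> holds A -> holds B -> holds C.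
Proof. intros p HA HB. apply (holds_entail p). now intros D [<-|[<-|[]]]. Qed.

Lemma holds_bot (n : nat) : ~ holds (n := n) ⊥%fm.
Proof. intros [m [_ p]]. exact (hyps_consistent p). Qed.

(** The code of a pair bounds its first component, so the step that names stage [n] does not precede
    [n]. *)
Lemma item_code (n : nat) (A : fm (stage n)) (t : ty) :
  exists m, n <= m /\ new_ty m = t /\ item m = fsub (up n m) A.
Proof.
exists (to_nat (n, to_nat (code_fm A, code_ty t))).
pose proof (to_nat_non_decreasing n (to_nat (code_fm A, code_ty t))) as h.
split; [lia|]. unfold new_ty, item. rewrite !cancel_of_to; cbn [fst snd].
rewrite !cancel_of_to; cbn [fst snd]. rewrite (codeK _ code_ty_inj).
split; [reflexivity|]. now rewrite (codeK _ (@code_fm_inj _)).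
Qed.

(** At the step that treats the formula it either becomes a hypothesis or is inconsistent with the
    current ones, and the latter is a derivation of its negation. *)
Lemma holds_complete (n : nat) (A : fm (stage n)) : holds A \/ holds (∼ A)%fm.
Proof.
destruct (item_code A O0) as [m [h [_ E]]].
destruct (classic (consistent (item m :: hyps m))) as [c|c].
- left. exists (S m). split; [lia|]. rewrite fsub_up_S by assumption.
  apply prf_hyp. cbn [hyps]. unfold next_hyps.
  destruct excluded_middle_informative as [_|c']; [|contradiction].
  apply in_or_app; right; left. now rewrite E.
- right. exists m. split; [assumption|]. cbn [fsub]. rewrite <- E. now apply prf_impI, NNPP.
Qed.

Lemma holds_imp (n : nat) (A B : fm (stage n)) : holds (A ⊃ B)%fm <-> (holds A -> holds B).
Proof.
split.
- intros HI HA. refine (holds_entail2 _ HI HA).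
  eapply prf_impE; apply prf_hyp; simpl; eauto.
- intros HAB. destruct (holds_complete A) as [HA|HA].
  + refine (holds_entail1 _ (HAB HA)). apply prf_impI, prf_hyp; simpl; auto.
  + refine (holds_entail1 _ HA). apply prf_impI, prf_botE.
    eapply prf_impE; apply prf_hyp; simpl; eauto.
Qed.

Lemma holds_and (n : nat) (A B : fm (stage n)) : holds (A ⋀ B)%fm <-> holds A /\ holds B.
Proof.
split.
- intros HA. split; refine (holds_entail1 _ HA).
  + eapply prf_andE1, prf_hyp0.
  + eapply prf_andE2, prf_hyp0.
- intros [HA HB]. refine (holds_entail2 _ HA HB). apply prf_andI; apply prf_hyp; simpl; auto.
Qed.

Lemma holds_or (n : nat) (A B : fm (stage n)) : holds (A ⋁ B)%fm <-> holds A \/ holds B.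
Proof.
split.
- intros HO. destruct (holds_complete A) as [HA|HA]; [now left|right].
  refine (holds_entail2 _ HO HA).
  eapply prf_orE; [apply prf_hyp0|apply prf_botE|apply prf_hyp0].
  eapply prf_impE; apply prf_hyp; simpl; eauto.
- intros [HA|HB].
  + refine (holds_entail1 _ HA). apply prf_orI1, prf_hyp0.
  + refine (holds_entail1 _ HB). apply prf_orI2, prf_hyp0.
Qed.

(** The witness is the variable declared when the existential formula is treated, which is why terms
    of later stages must be allowed. *)
Lemma holds_ex (n : nat) (s : ty) (A : fm (s :: stage n)) :
  holds (fex A) <-> exists m (a : tm (stage m) s), n <= m /\ holds (fsub (scons a (up n m)) A).
Proof.
split.
- intros HE. destruct (item_code (fex A) s) as [m [h [Es E]]].
  assert (c : consistent (item m :: hyps m)).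
  { intros p. rewrite E in p. apply (holds_bot (n := m)).
    rewrite (holds_up _ h) in HE.
    assert (HN : holds (∼ fsub (up n m) (∃[s] A))%fm).
    { exists m. split; [lia|]. rewrite up_refl, fsub_id. now apply prf_impI. }
    now apply (proj1 (holds_imp _ _) HN). }
  assert (HW : In (fsub (sup (up n m)) A) (witness s (fsub (up n m) (∃[s] A))%fm)).
  { cbn [fsub]. rewrite witness_fex. now left. }
  (* Once [s] is replaced by [new_ty m], the newest variable of stage [S m] has the right type and
     can serve as the witness. *)
  exists (S m). rewrite <- E in HW. revert A HE E HW. rewrite <- Es. intros A HE E HW.
  exists v0. split; [lia|].
  exists (S m). split; [lia|]. rewrite up_refl, fsub_id, up_S by assumption.
  apply prf_hyp. cbn [hyps]. unfold next_hyps.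
  destruct excluded_middle_informative as [_|c']; [|contradiction].
  apply in_or_app; left. exact HW.
- intros [m [a [h HA]]]. apply (holds_up _ h). refine (holds_entail1 _ HA).
  cbn [fsub]. apply prf_exI with a. rewrite finst_fsub_sup. apply prf_hyp0.
Qed.

Lemma finst_rup_vz (G : ctx) (s : ty) (A : fm (s :: G)) :
  finst (fren (rup (fun t (x : var G t) => vs (t := s) x)) A) v0 = A.
Proof.
unfold finst. rewrite fren_as_fsub, fsub_fsub. rewrite <- (fsub_id A) at 2. f_equal.
extensionality t; extensionality x. revert t x. apply var_cons_ind; reflexivity.
Qed.

Lemma prf_not_all (G : ctx) (s : ty) (A : fm (s :: G)) : prf T [(∼ ∀[s] A)%fm] (∃[s] ∼ A)%fm.
Proof.
apply prf_dne, prf_impI. eapply prf_impE; [apply prf_hyp; right; now left|].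
apply prf_allI, prf_dne, prf_impI.
eapply prf_impE; [apply prf_hyp; right; left; reflexivity|].
(* The generic variable itself is the counterexample. *)
apply prf_exI with v0.
exact (eq_ind_r (fun B => prf T _ B) (prf_hyp0 _ _ _) (finst_rup_vz (∼ A)%fm)).
Qed.

Lemma holds_all (n : nat) (s : ty) (A : fm (s :: stage n)) :
  holds (fall A) <-> forall m (a : tm (stage m) s), n <= m -> holds (fsub (scons a (up n m)) A).
Proof.
split.
- intros HA m a h. rewrite (holds_up _ h) in HA. refine (holds_entail1 _ HA).
  rewrite <- finst_fsub_sup. apply prf_allE, prf_hyp0.
- intros HA. destruct (holds_complete (fall A)) as [|HN]; [assumption|].
  apply (holds_entail1 (prf_not_all _)), holds_ex in HN as [m [a [h HN]]].
  destruct (holds_bot (n := m)). exact (proj1 (holds_imp _ _) HN (HA m a h)).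
Qed.

Lemma holds_eqt_arr (n : nat) (s t : ty) (f g : tm (stage n) (s ⇒ t)) :
  holds (eqt f g) <-> forall m (a : tm (stage m) s), n <= m ->
    holds (eqt (tsub (up n m) f · a) (tsub (up n m) g · a))%tm.
Proof.
cbn [eqt]. rewrite holds_all.
split; intros Hm m a h; specialize (Hm m a h);
  rewrite fsub_eqt in *; cbn [tsub] in *; now rewrite !tsub_scons_twk in *.
Qed.

Lemma holds_eqt_refl (s : ty) (n : nat) (a : tm (stage n) s) : holds (eqt a a).
Proof.
revert n a; induction s as [|s _ t IH]; intros n a.
- apply holds_prf, prf_refl.
- apply holds_eqt_arr. auto.
Qed.

Lemma holds_eqt_sym (s : ty) (n : nat) (a b : tm (stage n) s) : holds (eqt a b) -> holds (eqt b a).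
Proof.
revert n a b; induction s as [|s _ t IH]; intros n a b.
- apply holds_entail1. apply prf_eq_sym, prf_hyp0.
- rewrite !holds_eqt_arr. auto.
Qed.

Lemma holds_eqt_trans (s : ty) (n : nat) (a b c : tm (stage n) s) :
  holds (eqt a b) -> holds (eqt b c) -> holds (eqt a c).
Proof.
revert n a b c; induction s as [|s _ t IH]; intros n a b c.
- apply holds_entail2. apply prf_eq_trans with b; apply prf_hyp; simpl; auto.
- rewrite !holds_eqt_arr. intros Hab Hbc m x h. eapply IH; auto.
Qed.

(** Changing the function is an instance of the definition of equality at arrow types; changing the
    argument is the axiom of extensionality. *)
Lemma holds_eqt_app (s t : ty) (n : nat) (f g : tm (stage n) (s ⇒ t)) (a b : tm (stage n) s) :
  holds (eqt f g) -> holds (eqt a b) -> holds (eqt (f · a) (g · b))%tm.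
Proof.
intros Hf Ha. apply holds_eqt_trans with (g · a)%tm.
- rewrite holds_eqt_arr in Hf. specialize (Hf n a (le_n _)). now rewrite up_refl, !tsub_id in Hf.
- revert Ha. apply holds_imp, holds_prf, prf_ax, T_ext.
Qed.

(** * The term model *)

Definition elt (s : ty) : Type := {n : nat & tm (stage n) s}.

Definition at_stage (m : nat) (s : ty) (a : elt s) : tm (stage m) s :=
  tsub (up (projT1 a) m) (projT2 a).

(** Terms of different stages are compared at a common later one; by [elt_eq_at] the choice of that
    stage is immaterial. *)
Definition elt_eq (s : ty) (a b : elt s) : Prop :=
  exists m, projT1 a <= m /\ projT1 b <= m /\ holds (eqt (at_stage m a) (at_stage m b)).

Lemma at_stage_up (n m : nat) (s : ty) (a : elt s) :
  projT1 a <= n -> n <= m -> tsub (up n m) (at_stage n a) = at_stage m a.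
Proof. intros h1 h2. now apply tsub_up. Qed.

Lemma elt_eq_at (n : nat) (s : ty) (a b : elt s) :
  projT1 a <= n -> projT1 b <= n -> elt_eq a b <-> holds (eqt (at_stage n a) (at_stage n b)).
Proof.
intros ha hb; split; [intros [m [h1 [h2 H]]]|now exists n].
apply (holds_up _ (Nat.le_max_l n m)). apply (holds_up _ (Nat.le_max_r n m)) in H.
rewrite fsub_eqt, !at_stage_up in * by lia. exact H.
Qed.

Lemma elt_eq_equivalence (s : ty) : Equivalence (@elt_eq s).
Proof.
split.
- intros a. apply (elt_eq_at (le_n _) (le_n _)). apply holds_eqt_refl.
- intros a b. rewrite !(@elt_eq_at (max (projT1 a) (projT1 b))) by lia. apply holds_eqt_sym.
- intros a b c. rewrite !(@elt_eq_at (max (projT1 a) (max (projT1 b) (projT1 c)))) by lia.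
  apply holds_eqt_trans.
Qed.

Definition tdom (s : ty) : Type := quot (@elt_eq s).

Definition cl (n : nat) (s : ty) (a : tm (stage n) s) : tdom s :=
  cls (@elt_eq s) (existT (fun n => tm (stage n) s) n a).

Lemma cl_eq (n : nat) (s : ty) (a b : tm (stage n) s) : cl a = cl b <-> holds (eqt a b).
Proof.
unfold cl. rewrite (cls_eq (elt_eq_equivalence s)), (@elt_eq_at n) by auto. unfold at_stage; simpl.
now rewrite up_refl, !tsub_id.
Qed.

Lemma cl_up (n m : nat) (s : ty) (a : tm (stage n) s) : n <= m -> cl (tsub (up n m) a) = cl a.
Proof.
intros h. apply (cls_eq (elt_eq_equivalence s)), (@elt_eq_at m); simpl; auto.
unfold at_stage; simpl. rewrite up_refl, tsub_id. apply holds_eqt_refl.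
Qed.

Lemma cl_at (m : nat) (s : ty) (q : tdom s) : projT1 (rep q) <= m -> cl (at_stage m (rep q)) = q.
Proof.
intros h. unfold at_stage. rewrite cl_up by assumption.
rewrite <- (cls_rep q) at 3. unfold cl. now destruct (rep q).
Qed.

Definition tapply (s t : ty) (f : tdom (s ⇒ t)) (x : tdom s) : tdom t :=
  let m := max (projT1 (rep f)) (projT1 (rep x)) in
  cl (at_stage m (rep f) · at_stage m (rep x))%tm.

Lemma tapply_cl (n : nat) (s t : ty) (f : tm (stage n) (s ⇒ t)) (a : tm (stage n) s) :
  tapply (cl f) (cl a) = cl (f · a)%tm.
Proof.
unfold tapply. set (x := rep (cl f)). set (y := rep (cl a)). set (m := max (projT1 x) (projT1 y)).
set (p := max n m).
assert (h : n <= p /\ m <= p /\ projT1 x <= m /\ projT1 y <= m) by (unfold p, m; lia).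
clearbody m p. destruct h as [hn [hm [hx hy]]].
rewrite <- (cl_up (f · a)%tm hn), <- (cl_up (at_stage m x · at_stage m y)%tm hm). cbn [tsub].
rewrite !at_stage_up by assumption. apply cl_eq, holds_eqt_app; apply cl_eq; unfold x, y in *;
  rewrite cl_at, cl_up by lia; reflexivity.
Qed.

Definition tlt (x y : tdom O0) : Prop :=
  let m := max (projT1 (rep x)) (projT1 (rep y)) in
  holds (at_stage m (rep x) ≺ at_stage m (rep y))%fm.

Lemma holds_lt_congr (n : nat) (a a' b b' : tm (stage n) O0) :
  cl a = cl a' -> cl b = cl b' -> holds (a ≺ b)%fm -> holds (a' ≺ b')%fm.
Proof.
intros Ea Eb HL. apply cl_eq in Ea, Eb; cbn [eqt] in Ea, Eb.
assert (HL' : holds (a' ≺ b)%fm).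
{ refine (holds_entail2 _ Ea HL).
  pose proof (prf_leibniz (T := T) (H := [(a ≡ a')%fm; (a ≺ b)%fm]) (A := (v0 ≺ ↑b)%fm) (a := a) (b := a')) as L.
  unfold finst in L; cbn in L. rewrite !tsub_scons_twk, !tsub_id in L.
  apply L; apply prf_hyp; simpl; auto. }
refine (holds_entail2 _ Eb HL').
pose proof (prf_leibniz (T := T) (H := [(b ≡ b')%fm; (a' ≺ b)%fm]) (A := (↑a' ≺ v0)%fm) (a := b) (b := b')) as L.
unfold finst in L; cbn in L. rewrite !tsub_scons_twk, !tsub_id in L.
apply L; apply prf_hyp; simpl; auto.
Qed.

Lemma tlt_cl (n : nat) (a b : tm (stage n) O0) : tlt (cl a) (cl b) <-> holds (a ≺ b)%fm.
Proof.
unfold tlt. set (x := rep (cl a)). set (y := rep (cl b)). set (m := max (projT1 x) (projT1 y)).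
set (p := max n m).
assert (h : n <= p /\ m <= p /\ projT1 x <= m /\ projT1 y <= m) by (unfold p, m; lia).
clearbody m p. destruct h as [hn [hm [hx hy]]].
rewrite (holds_up (a ≺ b)%fm hn), (holds_up (at_stage m x ≺ at_stage m y)%fm hm). cbn [fsub].
rewrite !at_stage_up by assumption.
split; apply holds_lt_congr; unfold x, y in *; rewrite cl_at, cl_up by lia; reflexivity.
Qed.

Definition term_model : structure :=
  @Structure tdom tapply (@cl 0 _ tzero) (@cl 0 _ tone) (@cl 0 _ tplus) (@cl 0 _ ttimes)
    (fun s t => @cl 0 _ tPi) (fun r s t => @cl 0 _ tSigma) (@cl 0 _ tRec) tlt.

Definition cl_env (G : ctx) (n : nat) (r : sub G (stage n)) : env term_model G :=
  fun s x => cl (r s x).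

Lemma eval_cl (G : ctx) (n : nat) (r : sub G (stage n)) (s : ty) (a : tm G s) :
  eval (cl_env r) a = cl (tsub r a).
Proof.
induction a; try exact (eq_sym (cl_up _ (le_0_n n))); [reflexivity|].
cbn. now rewrite IHa1, IHa2, tapply_cl.
Qed.

Lemma cl_env_up (G : ctx) (n m : nat) (r : sub G (stage n)) :
  n <= m -> cl_env (fun s x => tsub (up n m) (r s x)) = cl_env r.
Proof. intros h. extensionality s; extensionality x. now apply cl_up. Qed.

Lemma econs_cl (G : ctx) (n : nat) (r : sub G (stage n)) (s : ty) (a : tm (stage n) s) :
  econs (M := term_model) (cl a) (cl_env r) = cl_env (scons a r).
Proof. apply vcase_ext; reflexivity. Qed.

Lemma cl_surj (n : nat) (s : ty) (q : tdom s) : exists m (a : tm (stage m) s), n <= m /\ q = cl a.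
Proof.
set (m := max n (projT1 (rep q))). exists m, (at_stage m (rep q)).
split; [lia|]. rewrite cl_at by lia. reflexivity.
Qed.

(** The truth lemma. At a quantifier the element may live at a later stage, so the whole environment
    is first moved there, which does not change its classes. *)
Lemma sat_cl (G : ctx) (A : fm G) (n : nat) (r : sub G (stage n)) :
  sat (cl_env r) A <-> holds (fsub r A).
Proof.
revert n r; induction A as [G a b|G a b|G|G A IHA B IHB|G A IHA B IHB|G A IHA B IHB|G s A IH|G s A IH];
  intros n r; cbn [sat fsub].
- now rewrite !eval_cl, cl_eq.
- rewrite !eval_cl. apply tlt_cl.
- split; [contradiction|apply holds_bot].
- now rewrite IHA, IHB, holds_imp.
- now rewrite IHA, IHB, holds_and.
- now rewrite IHA, IHB, holds_or.
- rewrite holds_all. split.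
  + intros HA m a h. rewrite fsub_scons_sup. apply IH.
    rewrite <- econs_cl, cl_env_up by assumption. apply HA.
  + intros HA d. destruct (cl_surj n d) as [m [a [h ->]]].
    rewrite <- (cl_env_up r h), econs_cl. apply IH. rewrite <- fsub_scons_sup. auto.
- rewrite holds_ex. split.
  + intros [d HA]. destruct (cl_surj n d) as [m [a [h ->]]]. exists m, a. split; [assumption|].
    rewrite <- (cl_env_up r h), econs_cl in HA. apply IH in HA. now rewrite fsub_scons_sup.
  + intros [m [a [h HA]]]. exists (cl a). rewrite fsub_scons_sup in HA. apply IH in HA.
    now rewrite <- econs_cl, cl_env_up in HA by assumption.
Qed.

(** [holds_eqt_arr] tests equality on the terms of all later stages, and these represent every
    element of the argument domain. *)
Lemma term_model_extensional : extensional term_model.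
Proof.
intros s t f g E. destruct (cl_surj 0 f) as [n [f' [_ ->]]].
destruct (cl_surj n g) as [m [g' [h ->]]]. rewrite <- (cl_up f' h) in E |- *.
apply cl_eq, holds_eqt_arr. intros p a hp. apply cl_eq.
rewrite <- !tapply_cl.
rewrite (cl_up _ hp), (cl_up _ hp). exact (E (cl a)).
Qed.

Lemma cl_env_surj (G : ctx) (e : env term_model G) :
  exists n (r : sub G (stage n)), e = cl_env r.
Proof.
induction G as [|s G IH].
- exists 0, (fun s (x : var [] s) => match x with end).
  extensionality s; extensionality x. inversion x.
- destruct (IH (fun t x => e t (vs x))) as [n [r Er]].
  destruct (cl_surj n (e s vz)) as [m [a [h Ea]]].
  exists m, (scons a (fun s x => tsub (up n m) (r s x))).
  rewrite <- econs_cl, cl_env_up by assumption. symmetry. apply vcase_ext; [exact Ea|].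
  intros t x. now rewrite <- Er.
Qed.

Lemma term_model_models : models term_model T.
Proof.
intros G A e HA. destruct (cl_env_surj e) as [n [r ->]].
apply sat_cl, holds_prf, prf_ax, T_sub, HA.
Qed.

Lemma term_model_refutes : ~ sat (enil term_model) A0.
Proof.
intros HA.
replace (enil term_model) with (cl_env (n := 0) (fun s (x : var [] s) => tvar x)) in HA
  by (extensionality s; extensionality x; inversion x).
apply sat_cl in HA. rewrite fsub_id in HA.
apply (holds_bot (n := 0)), (proj1 (holds_imp (n := 0) A0 ⊥%fm)); [|exact HA].
exists 0. split; [lia|]. rewrite up_refl, fsub_id. apply prf_hyp0.
Qed.

End Henkin.

Theorem completeness (T : theory) (A : fm []) :
  sub_closed T ->
  (forall G s t (f : tm G (s ⇒ t)%ty) (x y : tm G s), T G (eqt x y ⊃ eqt (f · x) (f · y))%fm) ->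
  (forall M, extensional M -> models M T -> sat (enil M) A) ->
  provable T A.
Proof.
intros T_sub T_ext HA. apply NNPP. intros HN.
apply (term_model_refutes T_sub T_ext HN), HA.
- now apply term_model_extensional.
- now apply term_model_models.
Qed.
(** * Closure of the axioms under substitution *)

Lemma qf_fsub (G D : ctx) (r : sub G D) (A : fm G) : qf A -> qf (fsub r A).
Proof. revert D r; induction A; simpl; intuition. Qed.

(** Substitution maps instances of a schema to instances. For induction and choice this requires
    commuting it with the substitution that the schema performs under its own quantifiers. *)
Lemma RCA0omega_sub_closed : sub_closed RCA0omega.
Proof.
intros G D r A [B HB|s t x y|r0 s t x y z|f m|f m n|s t f x y|B HB|B HB].
- apply rca_semiring. destruct HB; cbn; constructor.
- rewrite fsub_eqt. apply rca_Pi.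
- rewrite fsub_eqt. apply rca_Sigma.
- apply rca_Rec0.
- apply rca_RecS.
- cbn [fsub]. rewrite !fsub_eqt. apply rca_ext.
- replace (fsub r (induction_for B)) with (induction_for (fsub (sup r) B)).
  + apply rca_ind, qf_fsub, HB.
  + unfold induction_for. cbn [fsub]. rewrite fsub_finst, !fsub_fsub.
    do 5 f_equal. extensionality s; extensionality x. revert s x.
    apply var_cons_ind; [reflexivity|]. intros s x. cbn. rewrite tsub_scons_twk. symmetry. apply tren_as_tsub.
- replace (fsub r (choice_for B)) with (choice_for (fsub (sup (sup r)) B)).
  + apply rca_QFAC10, qf_fsub, HB.
  + unfold choice_for. cbn [fsub]. rewrite !fsub_fsub.
    do 5 f_equal. extensionality s; extensionality x. revert s x.
    apply var_cons_ind; [reflexivity|]. apply var_cons_ind; [reflexivity|].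
    intros s x. cbn. unfold twk. rewrite !tsub_tren. cbn.
    rewrite !tren_tren, tren_as_tsub. reflexivity.
Qed.

(** * Evaluation *)

Lemma eval_tren (M : structure) (G D : ctx) (r : ren G D) (e : env M D) (s : ty) (a : tm G s) :
  eval e (tren r a) = eval (fun s x => e s (r s x)) a.
Proof. induction a; simpl; congruence. Qed.

Lemma eval_twk (M : structure) (G : ctx) (t : ty) (d : dom M t) (e : env M G) (s : ty) (a : tm G s) :
  eval (econs d e) (twk a) = eval e a.
Proof. apply eval_tren. Qed.

Lemma eval_tsub (M : structure) (G D : ctx) (r : sub G D) (e : env M D) (s : ty) (a : tm G s) :
  eval e (tsub r a) = eval (fun s x => eval e (r s x)) a.
Proof. induction a; simpl; congruence. Qed.

Lemma sat_fsub (M : structure) (G D : ctx) (r : sub G D) (e : env M D) (A : fm G) :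
  sat e (fsub r A) <-> sat (fun s x => eval e (r s x)) A.
Proof.
assert (Hup : forall G D (r : sub G D) (e : env M D) t (d : dom M t),
  (fun s x => eval (econs d e) (sup r x)) = econs d (fun s x => eval e (r s x))).
{ clear. intros G D r e t d. symmetry; apply vcase_ext; [reflexivity|].
  intros s x. cbn. apply eval_twk. }
revert D r e; induction A as [G a b|G a b|G|G A IHA B IHB|G A IHA B IHB|G A IHA B IHB|G s A IH|G s A IH];
  intros D r e; cbn [sat fsub]; rewrite ?eval_tsub, ?IHA, ?IHB; try reflexivity.
- split; intros HA d; [rewrite <- Hup; apply IH, HA|apply IH; rewrite Hup; apply HA].
- split; intros [d HA]; exists d; [rewrite <- Hup; apply IH, HA|apply IH; rewrite Hup; apply HA].
Qed.

Lemma sat_fren (M : structure) (G D : ctx) (r : ren G D) (e : env M D) (A : fm G) :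
  sat e (fren r A) <-> sat (fun s x => e s (r s x)) A.
Proof. rewrite fren_as_fsub. apply sat_fsub. Qed.

(** * Combinators and arithmetic in an extensional model *)

Section Model.

Variable M : structure.
Hypothesis M_ext : extensional M.
Hypothesis M_models : models M RCA0omega.

Local Notation N := (dom M O0).
Local Notation Seq := (dom M O1).
Local Notation "f • x" := (app f x) (at level 20, left associativity).

Lemma sat_eqt (s : ty) (G : ctx) (e : env M G) (a b : tm G s) :
  sat e (eqt a b) <-> eval e a = eval e b.
Proof.
revert G e a b; induction s as [|s _ t IH]; intros G e a b; [reflexivity|].
cbn [eqt sat]. split.
- intros HE. apply M_ext. intros x. specialize (HE x). apply IH in HE.
  cbn [eval] in HE. now rewrite !eval_twk in HE.
- intros E d. apply IH. cbn [eval]. now rewrite !eval_twk, E.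
Qed.

Lemma PiE (s t : ty) (x : dom M s) (y : dom M t) : Pi M s t • x • y = x.
Proof. exact (proj1 (sat_eqt _ _ _) (M_models (econs x (econs y (enil M))) (rca_Pi (x := v0) (y := v1)))). Qed.

Lemma SigmaE (r s t : ty) (x : dom M (r ⇒ s ⇒ t)%ty) (y : dom M (r ⇒ s)%ty) (z : dom M r) :
  Sigma M r s t • x • y • z = x • z • (y • z).
Proof.
exact (proj1 (sat_eqt _ _ _)
  (M_models (econs x (econs y (econs z (enil M)))) (rca_Sigma (x := v0) (y := v1) (z := v2)))).
Qed.

Lemma lamE (G : ctx) (e : env M G) (s t : ty) (b : tm (s :: G) t) (d : dom M s) :
  eval e (lam b) • d = eval (econs d e) b.
Proof.
induction b as [t x|t u f IHf a IHa| | | | | | |]; cbn [lam eval]; try apply PiE.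
- revert t x. apply var_cons_ind.
  + cbn. now rewrite SigmaE, PiE.
  + intros t x. cbn. apply PiE.
- now rewrite SigmaE, IHf, IHa.
Qed.

Declare Scope model_scope.
Delimit Scope model_scope with model.
Local Open Scope model_scope.

Definition add (x y : N) : N := plus M • x • y.
Definition mul (x y : N) : N := times M • x • y.
Definition le (x y : N) : Prop := lt x y \/ x = y.

Local Notation "0" := (zero M) : model_scope.
Local Notation "1" := (one M) : model_scope.
Local Infix "+" := add : model_scope.
Local Infix "*" := mul : model_scope.
Local Infix "<" := (@lt M) : model_scope.
Local Infix "<=" := le : model_scope.

Lemma RecE0 (f : dom M (O0 ⇒ O0 ⇒ O0)%ty) (m : N) : Rec M • f • m • 0 = m.
Proof. exact (M_models (econs f (econs m (enil M))) (rca_Rec0 (f := v0) (m := v1))). Qed.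

Lemma RecES (f : dom M (O0 ⇒ O0 ⇒ O0)%ty) (m n : N) :
  Rec M • f • m • (n + 1) = f • n • (Rec M • f • m • n).
Proof. exact (M_models (econs f (econs m (econs n (enil M)))) (rca_RecS (f := v0) (m := v1) (n := v2))). Qed.

Definition env3 (x y z : N) : env M [O0; O0; O0] := econs x (econs y (econs z (enil M))).

Lemma sat_semiring (x y z : N) (A : fm [O0; O0; O0]) : ordered_semiring A -> sat (env3 x y z) A.
Proof. intros HA. now apply M_models, rca_semiring. Qed.

Lemma addA (x y z : N) : x + (y + z) = x + y + z.
Proof. exact (sat_semiring x y z (os_addA (a := v0) (b := v1) (c := v2))). Qed.
Lemma addC (x y : N) : x + y = y + x.
Proof. exact (sat_semiring x y x (os_addC (a := v0) (b := v1))). Qed.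
Lemma add0 (x : N) : x + 0 = x.
Proof. exact (sat_semiring x x x (os_add0 (a := v0))). Qed.
Lemma mulA (x y z : N) : x * (y * z) = x * y * z.
Proof. exact (sat_semiring x y z (os_mulA (a := v0) (b := v1) (c := v2))). Qed.
Lemma mulC (x y : N) : x * y = y * x.
Proof. exact (sat_semiring x y x (os_mulC (a := v0) (b := v1))). Qed.
Lemma mul1 (x : N) : x * 1 = x.
Proof. exact (sat_semiring x x x (os_mul1 (a := v0))). Qed.
Lemma mul0 (x : N) : x * 0 = 0.
Proof. exact (sat_semiring x x x (os_mul0 (a := v0))). Qed.
Lemma mulD (x y z : N) : x * (y + z) = x * y + x * z.
Proof. exact (sat_semiring x y z (os_mulD (a := v0) (b := v1) (c := v2))). Qed.
Lemma lt_irr (x : N) : ~ x < x.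
Proof. exact (sat_semiring x x x (os_lt_irr (a := v0))). Qed.
Lemma lt_trans (x y z : N) : x < y -> y < z -> x < z.
Proof. exact (sat_semiring x y z (os_lt_trans (a := v0) (b := v1) (c := v2))). Qed.
Lemma lt_total (x y : N) : x < y \/ x = y \/ y < x.
Proof. destruct (sat_semiring x y x (os_lt_total (a := v0) (b := v1))) as [?|[?|?]]; auto. Qed.
Lemma lt_add (x y z : N) : x < y -> x + z < y + z.
Proof. exact (sat_semiring x y z (os_lt_add (a := v0) (b := v1) (c := v2))). Qed.
Lemma lt_mul (x y z : N) : 0 < z -> x < y -> x * z < y * z.
Proof. exact (sat_semiring x y z (os_lt_mul (a := v0) (b := v1) (c := v2))). Qed.
Lemma lt01 : 0 < 1.
Proof. exact (sat_semiring 0 0 0 os_lt01). Qed.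

Lemma N_semi_ring : semi_ring_theory 0 1 add mul (@eq N).
Proof.
split; auto using addC, addA, mulC, mulA.
- intros x. now rewrite addC, add0.
- intros x. now rewrite mulC, mul1.
- intros x. now rewrite mulC, mul0.
- intros x y z. now rewrite mulC, mulD, (mulC z x), (mulC z y).
Qed.

Add Ring N_ring : N_semi_ring.

(** Numbers of the model may be nonstandard, so the inductions below name their formula explicitly;
    [change] or an equivalence then translates its instances into statements about the model. *)
Lemma qf_induction (G : ctx) (e : env M G) (A : fm (O0 :: G)) :
  qf A -> sat (econs 0 e) A -> (forall n, sat (econs n e) A -> sat (econs (n + 1) e) A) ->
  forall n, sat (econs n e) A.
Proof.
intros HA H0 HS. apply (M_models e (rca_ind HA)); cbn [sat].
- apply sat_fsub. refine (eq_ind _ (fun e => sat e A) H0 _ _).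
  apply vcase_ext; reflexivity.
- intros n Hn. apply sat_fsub. refine (eq_ind _ (fun e => sat e A) (HS n Hn) _ _).
  apply vcase_ext; reflexivity.
Qed.

Lemma le_refl (x : N) : x <= x.
Proof. now right. Qed.

Lemma lt_le (x y : N) : x < y -> x <= y.
Proof. now left. Qed.

Lemma le_lt_trans (x y z : N) : x <= y -> y < z -> x < z.
Proof. intros [h| ->]; [now apply lt_trans|trivial]. Qed.

Lemma lt_le_trans (x y z : N) : x < y -> y <= z -> x < z.
Proof. intros h [h'| <-]; [now apply lt_trans with y|trivial]. Qed.

Lemma le_trans (x y z : N) : x <= y -> y <= z -> x <= z.
Proof. intros h [h'| <-]; [left; now apply le_lt_trans with y|trivial]. Qed.

Lemma le_not_lt (x y : N) : x <= y -> ~ y < x.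
Proof. intros h h'. now apply (lt_irr (le_lt_trans h h')). Qed.

Lemma not_lt_le (x y : N) : ~ y < x -> x <= y.
Proof. destruct (lt_total x y) as [|[|]]; [now left|now right|contradiction]. Qed.

Lemma le_lt_dec (x y : N) : x <= y \/ y < x.
Proof. destruct (lt_total x y) as [|[|]]; [left; now left|left; now right|now right]. Qed.

Lemma le_add (x y z : N) : x <= y -> x + z <= y + z.
Proof. intros [h| ->]; [left; now apply lt_add|apply le_refl]. Qed.

Lemma le_add_inv (x y z : N) : x + z <= y + z -> x <= y.
Proof. intros h. apply not_lt_le. intros h'. now apply (le_not_lt h), lt_add. Qed.

Lemma add_cancel (x y z : N) : x + z = y + z -> x = y.
Proof.
intros E. destruct (lt_total x y) as [h|[h|h]]; [|assumption|];
  apply (lt_add z) in h; rewrite E in h; now apply lt_irr in h.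
Qed.

Lemma le_mul (x y z : N) : x <= y -> 0 < z -> x * z <= y * z.
Proof. intros [h| ->] hz; [left; now apply lt_mul|apply le_refl]. Qed.

Lemma lt_succ (x : N) : x < x + 1.
Proof. pose proof (lt_add x lt01) as h. now rewrite addC, add0, addC in h. Qed.

Lemma ge0 (x : N) : 0 <= x.
Proof.
apply (qf_induction (e := enil M) (A := fle 0 v0)); cbn; [auto|now right|].
intros n hn. left. now apply le_lt_trans with n, lt_succ.
Qed.

Lemma lt0_succ (x : N) : 0 < x + 1.
Proof. apply le_lt_trans with x; [apply ge0|apply lt_succ]. Qed.

Lemma le_addr (x y : N) : x <= x + y.
Proof. pose proof (le_add x (ge0 y)) as h. now rewrite addC, add0, addC in h. Qed.

Definition pred (x : N) : N := eval (econs x (enil M)) (tpred v0).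

Lemma pred0 : pred 0 = 0.
Proof. apply RecE0. Qed.

Lemma pred_succ (x : N) : pred (x + 1) = x.
Proof. unfold pred, tpred. cbn [eval econs vcase]. rewrite RecES, !lamE. reflexivity. Qed.

Lemma zero_or_succ (x : N) : x = 0 \/ x = pred x + 1.
Proof.
apply (qf_induction (e := enil M) (A := (v0 ≡ 0 ⋁ v0 ≡ tpred v0 + 1)%fm)); cbn [sat]; [cbn; auto|now left|].
intros n _. right. change (n + 1 = pred (n + 1) + 1). now rewrite pred_succ.
Qed.

Lemma pred_pos (x : N) : 0 < x -> pred x + 1 = x.
Proof. intros h. destruct (zero_or_succ x) as [->|E]; [now apply lt_irr in h|auto]. Qed.

Definition nsub (x y : N) : N := eval (econs x (econs y (enil M))) (tsubn v0 v1).

Lemma nsub0 (x : N) : nsub x 0 = x.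
Proof. apply RecE0. Qed.

Lemma nsubS (x y : N) : nsub x (y + 1) = pred (nsub x y).
Proof. unfold nsub, tsubn. cbn [eval econs vcase]. rewrite RecES, !lamE. reflexivity. Qed.

Lemma nsubK (x y : N) : y <= x -> y + nsub x y = x.
Proof.
(* The disjunction survives the step at which the difference reaches 0: there [n = x], and from
   [n + 1] on the left side holds. *)
enough (H : x < y \/ y + nsub x y = x).
{ intros h. destruct H as [h'|]; [now destruct (le_not_lt h h')|assumption]. }
apply (qf_induction (e := econs x (enil M)) (A := (v1 ≺ v0 ⋁ v0 + tsubn v1 v0 ≡ v1)%fm)).
- cbn; auto.
- right. change (0 + nsub x 0 = x). rewrite nsub0. ring.
- intros n. change (x < n \/ n + nsub x n = x -> x < n + 1 \/ n + 1 + nsub x (n + 1) = x).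
  intros [h|E]; [left; apply (lt_trans h (lt_succ n))|].
  rewrite nsubS. destruct (zero_or_succ (nsub x n)) as [E0|E1].
  + left. rewrite E0, add0 in E. rewrite <- E. apply lt_succ.
  + right. rewrite <- E at 2. rewrite E1 at 2. ring.
Qed.

Lemma le_exists (x y : N) : x <= y -> exists z, y = x + z.
Proof. intros h. exists (nsub y x). now rewrite nsubK. Qed.

Lemma lt_le_succ (x y : N) : x < y -> x + 1 <= y.
Proof.
intros h. destruct (le_exists (lt_le h)) as [z E]. subst y. destruct (zero_or_succ z) as [->|E].
- rewrite add0 in h. now apply lt_irr in h.
- rewrite E. replace (x + (pred z + 1)) with (x + 1 + pred z) by ring. apply le_addr.
Qed.

Lemma nsub_add (x y : N) : nsub (x + y) x = y.
Proof.
pose proof (nsubK (le_addr x y)) as E. apply add_cancel with x.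
now rewrite addC, E, addC.
Qed.

Lemma nsub_eq0 (x y : N) : nsub x y = 0 <-> x <= y.
Proof.
split.
- intros E. apply not_lt_le. intros h. pose proof (nsubK (lt_le h)) as E'.
  rewrite E, add0 in E'. subst. now apply lt_irr in h.
- intros h. destruct (le_exists h) as [z ->]. clear h. revert z.
  apply (qf_induction (e := econs x (enil M)) (A := (tsubn v1 (v1 + v0) ≡ 0)%fm)).
  + cbn; auto.
  + change (nsub x (x + 0) = 0). pose proof (nsub_add x 0) as E. now rewrite add0 in E |- *.
  + intros n. change (nsub x (x + n) = 0 -> nsub x (x + (n + 1)) = 0).
    intros E. now rewrite addA, nsubS, E, pred0.
Qed.

Definition cond (c x y : N) : N := eval (econs c (econs x (econs y (enil M)))) (tcond v0 v1 v2).

Lemma cond0 (x y : N) : cond 0 x y = x.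
Proof. apply RecE0. Qed.

Lemma condS (c x y : N) : c <> 0 -> cond c x y = y.
Proof.
intros hc. destruct (zero_or_succ c) as [E|E]; [contradiction|]. rewrite E.
unfold cond, tcond. cbn [eval econs vcase]. now rewrite RecES, !PiE.
Qed.

Definition exp2 (n : N) : N := eval (econs n (enil M)) (texp2 v0).

Lemma exp2_0 : exp2 0 = 1.
Proof. apply RecE0. Qed.

Lemma exp2_S (n : N) : exp2 (n + 1) = exp2 n + exp2 n.
Proof. unfold exp2, texp2. cbn [eval econs vcase]. rewrite RecES, !lamE. reflexivity. Qed.

Lemma add_pos (x y : N) : 0 < x -> 0 < x + y.
Proof. intros h. apply (lt_le_trans h), le_addr. Qed.

Lemma exp2_pos (n : N) : 0 < exp2 n.
Proof.
apply (qf_induction (e := enil M) (A := (0 ≺ texp2 v0)%fm)).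
- cbn; auto.
- change (0 < exp2 0). rewrite exp2_0. exact lt01.
- intros k. change (0 < exp2 k -> 0 < exp2 (k + 1)). rewrite exp2_S. apply add_pos.
Qed.

(** * Pairing *)

Definition tri (n : N) : N := eval (econs n (enil M)) (ttri v0).

Lemma tri0 : tri 0 = 0.
Proof. apply RecE0. Qed.

Lemma triS (n : N) : tri (n + 1) = tri n + (n + 1).
Proof. unfold tri, ttri. cbn [eval econs vcase]. rewrite RecES, !lamE. reflexivity. Qed.

Lemma tri_le (x y : N) : x <= y -> tri x <= tri y.
Proof.
intros h. destruct (le_exists h) as [z ->]. clear h. revert z.
apply (qf_induction (e := econs x (enil M)) (A := fle (ttri v1) (ttri (v1 + v0)))).
- cbn; auto.
- change (tri x <= tri (x + 0)). rewrite add0. apply le_refl.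
- intros n. change (tri x <= tri (x + n) -> tri x <= tri (x + (n + 1))).
  intros hn. rewrite addA, triS. apply (le_trans hn), le_addr.
Qed.

Definition root (n : N) : N := eval (econs n (enil M)) (troot v0).

Lemma root0 : root 0 = 0.
Proof. apply RecE0. Qed.

Lemma rootS (n : N) :
  root (n + 1) = cond (nsub (tri (root n + 1)) (n + 1)) (root n + 1) (root n).
Proof. unfold root, troot. cbn [eval econs vcase]. rewrite RecES, !lamE. reflexivity. Qed.

(** Triangular numbers after [tri r] are spaced by at least one, so passing to the next number
    raises the root by at most one, and the single test in the recursion suffices. *)
Lemma root_spec (n : N) : tri (root n) <= n /\ n < tri (root n + 1).
Proof.
refine (qf_induction (e := enil M) (A := (fle (ttri (troot v0)) v0 ⋀ v0 ≺ ttri (troot v0 + 1))%fm)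
  _ _ _ n).
- cbn; auto.
- change (tri (root 0) <= 0 /\ 0 < tri (root 0 + 1)). rewrite root0, triS, tri0. split; [apply le_refl|].
  replace (0 + (0 + 1)) with 1 by ring. exact lt01.
- intros k. change (tri (root k) <= k /\ k < tri (root k + 1) ->
    tri (root (k + 1)) <= k + 1 /\ k + 1 < tri (root (k + 1) + 1)).
  intros [h1 h2]. rewrite rootS. set (r := root k) in *.
  destruct (le_lt_dec (tri (r + 1)) (k + 1)) as [h|h].
  + rewrite (proj2 (nsub_eq0 _ _) h), cond0. split; [assumption|].
    rewrite (triS (r + 1)). apply le_lt_trans with (tri (r + 1)); [now apply lt_le_succ|].
    pose proof (lt_add (tri (r + 1)) (lt0_succ (r + 1))) as h3.
    replace (0 + tri (r + 1)) with (tri (r + 1)) in h3 by ring. now rewrite (addC (tri (r + 1))).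
  + rewrite condS.
    * split; [|assumption]. apply (le_trans h1), lt_le, lt_succ.
    * intros E. apply nsub_eq0 in E. now apply (le_not_lt E).
Qed.

Definition pair (x y : N) : N := tri (x + y) + x.
Definition fst (n : N) : N := nsub n (tri (root n)).
Definition snd (n : N) : N := nsub (root n) (fst n).

(** The code lies between [tri (x + y)] and [tri (x + y + 1)]; as [tri] is monotone, only one root
    is compatible with these bounds. *)
Lemma root_pair (x y : N) : root (pair x y) = x + y.
Proof.
destruct (root_spec (pair x y)) as [h1 h2]. unfold pair in *. set (r := root _) in *.
destruct (lt_total r (x + y)) as [h|[h|h]]; [|assumption|].
- apply lt_le_succ, tri_le in h. destruct (le_not_lt h). apply (le_lt_trans (le_addr _ x) h2).
- apply lt_le_succ, tri_le in h. rewrite triS in h.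
  destruct (le_not_lt (le_trans h h1)).
  rewrite !(addC (tri (x + y))). apply lt_add.
  apply le_lt_trans with (x + y); [apply le_addr|apply lt_succ].
Qed.

Lemma fst_pair (x y : N) : fst (pair x y) = x.
Proof. unfold fst. rewrite root_pair. apply nsub_add. Qed.

Lemma snd_pair (x y : N) : snd (pair x y) = y.
Proof. unfold snd. rewrite fst_pair, root_pair. apply nsub_add. Qed.

(** * Rationals *)

Definition rmk (u v w : N) : N := pair u (pair v w).
Definition pos (a : N) : N := fst a.
Definition neg (a : N) : N := fst (snd a).
Definition den (a : N) : N := snd (snd a) + 1.

Lemma pos_rmk (u v w : N) : pos (rmk u v w) = u.
Proof. apply fst_pair. Qed.

Lemma neg_rmk (u v w : N) : neg (rmk u v w) = v.
Proof. unfold neg, rmk. now rewrite snd_pair, fst_pair. Qed.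

Lemma den_rmk (u v w : N) : den (rmk u v w) = w + 1.
Proof. unfold den, rmk. now rewrite !snd_pair. Qed.

Lemma den_rmk_pred (u v w : N) : 0 < w -> den (rmk u v (pred w)) = w.
Proof. rewrite den_rmk. apply pred_pos. Qed.

Lemma den_pos (a : N) : 0 < den a.
Proof. apply lt0_succ. Qed.

Lemma mul_pos (x y : N) : 0 < x -> 0 < y -> 0 < x * y.
Proof. intros hx hy. pose proof (lt_mul hy hx) as h. now replace (0 * y) with 0 in h by ring. Qed.

Definition radd (a b : N) : N :=
  rmk (pos a * den b + pos b * den a) (neg a * den b + neg b * den a) (pred (den a * den b)).
Definition ropp (a : N) : N := rmk (neg a) (pos a) (pred (den a)).
(** Multiplication is absent from the formal statement; it completes the ring structure on which
    [ring] operates in the estimates. *)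
Definition rmul (a b : N) : N :=
  rmk (pos a * pos b + neg a * neg b) (pos a * neg b + neg a * pos b) (pred (den a * den b)).
Definition rabs (a : N) : N :=
  rmk (nsub (pos a) (neg a) + nsub (neg a) (pos a)) 0 (pred (den a)).

Definition rle (a b : N) : Prop := pos a * den b + neg b * den a <= pos b * den a + neg a * den b.
Definition req (a b : N) : Prop := pos a * den b + neg b * den a = pos b * den a + neg a * den b.

Lemma pos_radd (a b : N) : pos (radd a b) = pos a * den b + pos b * den a.
Proof. unfold radd. apply pos_rmk. Qed.
Lemma neg_radd (a b : N) : neg (radd a b) = neg a * den b + neg b * den a.
Proof. unfold radd. apply neg_rmk. Qed.
Lemma den_radd (a b : N) : den (radd a b) = den a * den b.
Proof. unfold radd. apply den_rmk_pred, mul_pos; apply den_pos. Qed.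
Lemma pos_ropp (a : N) : pos (ropp a) = neg a.
Proof. unfold ropp. apply pos_rmk. Qed.
Lemma neg_ropp (a : N) : neg (ropp a) = pos a.
Proof. unfold ropp. apply neg_rmk. Qed.
Lemma den_ropp (a : N) : den (ropp a) = den a.
Proof. unfold ropp. apply den_rmk_pred, den_pos. Qed.
Lemma pos_rmul (a b : N) : pos (rmul a b) = pos a * pos b + neg a * neg b.
Proof. unfold rmul. apply pos_rmk. Qed.
Lemma neg_rmul (a b : N) : neg (rmul a b) = pos a * neg b + neg a * pos b.
Proof. unfold rmul. apply neg_rmk. Qed.
Lemma den_rmul (a b : N) : den (rmul a b) = den a * den b.
Proof. unfold rmul. apply den_rmk_pred, mul_pos; apply den_pos. Qed.

Local Ltac fractions :=
  unfold rle, req;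
  rewrite ?pos_radd, ?neg_radd, ?den_radd, ?pos_ropp, ?neg_ropp, ?den_ropp,
    ?pos_rmul, ?neg_rmul, ?den_rmul, ?pos_radd, ?neg_radd, ?den_radd,
    ?pos_ropp, ?neg_ropp, ?den_ropp, ?pos_rmul, ?neg_rmul, ?den_rmul,
    ?pos_rmk, ?neg_rmk, ?den_rmk.

Lemma le_mul_inv (x y z : N) : 0 < z -> x * z <= y * z -> x <= y.
Proof. intros hz h. apply not_lt_le. intros h'. now apply (le_not_lt h), lt_mul. Qed.

Lemma le_add2 (x y x' y' : N) : x <= y -> x' <= y' -> x + x' <= y + y'.
Proof.
intros h h'. apply le_trans with (y + x'); [now apply le_add|].
rewrite !(addC y). now apply le_add.
Qed.

Lemma le_antisym (x y : N) : x <= y -> y <= x -> x = y.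
Proof. intros [h|h] h'; [now destruct (le_not_lt h')|assumption]. Qed.

Lemma rle_trans (a b c : N) : rle a b -> rle b c -> rle a c.
Proof.
unfold rle. intros h1 h2.
(* Scaling the two hypotheses by [den c] and [den a] and adding them gives the goal times [den b],
   up to the summand [z], which comes from the numerators of [b]. *)
apply (le_mul_inv (den_pos b)), (le_add_inv (z := neg b * den a * den c + pos b * den a * den c)).
pose proof (le_add2 (le_mul h1 (den_pos c)) (le_mul h2 (den_pos a))) as h.
match goal with |- ?L <= ?R => match type of h with ?L' <= ?R' =>
  replace L with L' by ring; replace R with R' by ring; exact h end end.
Qed.

Lemma rle_antisym (a b : N) : rle a b -> rle b a -> req a b.
Proof.
unfold rle, req. intros h h'. now apply le_antisym.
Qed.

Lemma req_rle (a b : N) : req a b -> rle a b.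
Proof. now right. Qed.

Lemma req_sym (a b : N) : req a b -> req b a.
Proof. unfold req. auto. Qed.

Lemma req_equivalence : Equivalence req.
Proof.
split.
- intros a. reflexivity.
- intros a b. apply req_sym.
- intros a b c h1 h2.
  apply rle_antisym; apply rle_trans with b; apply req_rle; auto using req_sym.
Qed.

(** A rational has many codes; in this quotient, formed outside the formal system, equality of
    rationals becomes identity. *)
Definition rat : Type := quot req.
Definition val (a : N) : rat := cls req a.

Lemma val_eq (a b : N) : val a = val b <-> req a b.
Proof. apply (cls_eq req_equivalence). Qed.

Lemma rat_val (x : rat) : exists a, x = val a.
Proof. apply cls_surj. Qed.

Lemma req_rep (a : N) : req (rep (val a)) a.
Proof. apply val_eq, cls_rep. Qed.

Definition kadd (x y : rat) : rat := val (radd (rep x) (rep y)).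
Definition kopp (x : rat) : rat := val (ropp (rep x)).
Definition kmul (x y : rat) : rat := val (rmul (rep x) (rep y)).
Definition ksub (x y : rat) : rat := kadd x (kopp y).
Definition kzero : rat := val (rmk 0 0 0).
Definition kone : rat := val (rmk 1 0 0).
Definition kle (x y : rat) : Prop := rle (rep x) (rep y).
Definition klt (x y : rat) : Prop := ~ kle y x.

Lemma kadd_val (a b : N) : kadd (val a) (val b) = val (radd a b).
Proof.
apply val_eq. pose proof (req_rep a) as Ha. pose proof (req_rep b) as Hb. revert Ha Hb.
generalize (rep (val a)) (rep (val b)). intros a' b'. fractions. intros Ha Hb.
transitivity (den b * den b' * (pos a' * den a + neg a * den a')
  + den a * den a' * (pos b' * den b + neg b * den b')); [ring|rewrite Ha, Hb; ring].
Qed.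

Lemma kopp_val (a : N) : kopp (val a) = val (ropp a).
Proof.
apply val_eq. pose proof (req_rep a) as Ha. revert Ha. generalize (rep (val a)). intros a'.
fractions. intros Ha. rewrite addC, <- Ha. apply addC.
Qed.

Lemma rmul_req (a a' b : N) : req a a' -> req (rmul a b) (rmul a' b).
Proof.
fractions. intros H.
set (p := pos a * den a' + neg a' * den a). set (q := pos a' * den a + neg a * den a').
transitivity (den b * (pos b * p + neg b * q)); [unfold p, q; ring|].
transitivity (den b * (pos b * q + neg b * p)); [|unfold p, q; ring].
change (p = q) in H. now rewrite H.
Qed.

Lemma rmulC (a b : N) : req (rmul a b) (rmul b a).
Proof. fractions. ring. Qed.

Lemma kmul_val (a b : N) : kmul (val a) (val b) = val (rmul a b).
Proof.
unfold kmul. transitivity (val (rmul a (rep (val b)))).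
- apply val_eq, rmul_req, req_rep.
- rewrite (proj2 (val_eq _ _) (rmulC _ _)). transitivity (val (rmul b a)).
  + apply val_eq, rmul_req, req_rep.
  + apply val_eq, rmulC.
Qed.

Lemma kle_val (a b : N) : kle (val a) (val b) <-> rle a b.
Proof.
unfold kle. pose proof (req_rep a) as Ha. pose proof (req_rep b) as Hb. split; intros h.
- apply rle_trans with (rep (val a)); [now apply req_rle, req_sym|].
  apply rle_trans with (rep (val b)); [assumption|now apply req_rle].
- apply rle_trans with a; [now apply req_rle|].
  apply rle_trans with b; [assumption|now apply req_rle, req_sym].
Qed.

Lemma klt_val (a b : N) :
  klt (val a) (val b) <-> pos a * den b + neg b * den a < pos b * den a + neg a * den b.
Proof.
unfold klt. rewrite kle_val. unfold rle.
split; intros h.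
- destruct (le_lt_dec (pos b * den a + neg a * den b) (pos a * den b + neg b * den a)) as [h'|h'];
    [contradiction|assumption].
- intros h'. now apply (le_not_lt h').
Qed.

Declare Scope rat_scope.
Local Open Scope rat_scope.
Local Infix "+" := kadd : rat_scope.
Local Infix "*" := kmul : rat_scope.
Local Infix "-" := ksub : rat_scope.
Local Notation "- x" := (kopp x) : rat_scope.
Local Notation "0" := kzero : rat_scope.
Local Notation "1" := kone : rat_scope.
Local Infix "<=" := kle : rat_scope.
Local Infix "<" := klt : rat_scope.

Local Ltac on_codes :=
  repeat match goal with x : rat |- _ => destruct (rat_val x) as [? ->] end.

Lemma rat_ring : ring_theory 0 1 kadd kmul ksub kopp eq.
Proof.
split; intros; unfold ksub, kzero, kone; on_codes; rewrite ?kopp_val, ?kadd_val, ?kmul_val, ?kadd_val;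
  try reflexivity; apply val_eq; fractions; ring.
Qed.

Add Ring rat_ring : rat_ring.

Lemma kle_refl (x : rat) : x <= x.
Proof. apply req_rle. reflexivity. Qed.

Lemma kle_trans (x y z : rat) : x <= y -> y <= z -> x <= z.
Proof. apply rle_trans. Qed.

Lemma kle_total (x y : rat) : x <= y \/ y <= x.
Proof.
unfold kle, rle. destruct (le_lt_dec (pos (rep x) * den (rep y) + neg (rep y) * den (rep x))
  (pos (rep y) * den (rep x) + neg (rep x) * den (rep y)))%model as [h|h]; [now left|right; now left].
Qed.

Lemma klt_kle (x y : rat) : x < y -> x <= y.
Proof. intros h. now destruct (kle_total x y). Qed.

Lemma kle_add (x y z : rat) : x <= y -> x + z <= y + z.
Proof.
destruct (rat_val x) as [a ->], (rat_val y) as [b ->], (rat_val z) as [c ->].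
rewrite !kadd_val, !kle_val. fractions. intros h.
apply (le_mul (z := (den c * den c)%model)) in h; [|apply mul_pos; apply den_pos].
apply (le_add (den a * den b * den c * (pos c + neg c))%model) in h.
match goal with |- le ?L ?R => match type of h with le ?L' ?R' =>
  replace L with L' by ring; replace R with R' by ring; exact h end end.
Qed.

(** With this form every linear estimate below is a sum of known inequalities followed by a ring
    identity between differences. *)
Lemma kle_by (x y x' y' : rat) : x <= y -> y - x = y' - x' -> x' <= y'.
Proof.
intros h E. apply (kle_add (x' - x)) in h.
replace (x + (x' - x)) with x' in h by ring.
replace (y + (x' - x)) with (y - x + x') in h by ring. rewrite E in h.
now replace (y' - x' + x') with y' in h by ring.
Qed.

Lemma klt_by (x y x' y' : rat) : x < y -> y - x = y' - x' -> x' < y'.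
Proof.
intros h E h'. apply h, (kle_by h').
replace (x' - y') with (- (y' - x')) by ring. rewrite <- E. ring.
Qed.

Lemma kle_add2 (x y x' y' : rat) : x <= y -> x' <= y' -> x + x' <= y + y'.
Proof.
intros h h'. apply kle_trans with (y + x'); [now apply kle_add|].
apply (kle_by h'). ring.
Qed.

Lemma klt_add2 (x y x' y' : rat) : x < y -> x' <= y' -> x + x' < y + y'.
Proof.
intros h h' h''. apply h. refine (kle_by (kle_add2 h'' h') _). ring.
Qed.

Lemma kle_klt_trans (x y z : rat) : x <= y -> y < z -> x < z.
Proof. intros h h' h''. apply h'. now apply kle_trans with x. Qed.

Local Opaque pos neg den rmk.

Definition kabs (x : rat) : rat := if excluded_middle_informative (0 <= x) then x else - x.

Lemma kabs_cases (x : rat) : 0 <= x /\ kabs x = x \/ x <= 0 /\ kabs x = - x.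
Proof.
unfold kabs. destruct excluded_middle_informative as [h|h]; [now left|right].
split; [|reflexivity]. now destruct (kle_total 0 x).
Qed.

Lemma kle_kabs (x c : rat) : kabs x <= c <-> x <= c /\ - x <= c.
Proof.
destruct (kabs_cases x) as [[h ->]|[h ->]]; split; [|intros []; assumption| |intros []; assumption];
  intros h'; (split; [|]); try assumption; refine (kle_trans _ h').
- refine (kle_by (kle_add2 h h) _). ring.
- refine (kle_by (kle_add2 h h) _). ring.
Qed.

Lemma klt_kabs (x c : rat) : kabs x < c <-> x < c /\ - x < c.
Proof.
destruct (kabs_cases x) as [[h ->]|[h ->]]; split; [|intros []; assumption| |intros []; assumption];
  intros h'; (split; [|]); try assumption; refine (kle_klt_trans _ h').
- refine (kle_by (kle_add2 h h) _). ring.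
- refine (kle_by (kle_add2 h h) _). ring.
Qed.

Lemma kabs_gt (x c : rat) : c < kabs x <-> c < x \/ c < - x.
Proof.
unfold klt. rewrite kle_kabs. tauto.
Qed.

Lemma kzero_le (a : N) : 0 <= val a <-> le (neg a) (pos a).
Proof.
unfold kzero. rewrite kle_val. fractions.
match goal with |- le ?L ?R <-> _ =>
  replace L with (neg a) by ring; replace R with (pos a) by ring end. reflexivity.
Qed.

Lemma den_rabs (a : N) : den (rabs a) = den a.
Proof. unfold rabs. apply den_rmk_pred, den_pos. Qed.

(** According to the sign, one of the two truncated differences vanishes and the other is the true
    one. *)
Lemma val_rabs (a : N) : val (rabs a) = kabs (val a).
Proof.
assert (Hp : pos (rabs a) = (nsub (pos a) (neg a) + nsub (neg a) (pos a))%model)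
  by (unfold rabs; apply pos_rmk).
assert (Hn : neg (rabs a) = zero M) by (unfold rabs; apply neg_rmk).
unfold kabs. destruct excluded_middle_informative as [h|h]; rewrite kzero_le in h.
- apply val_eq. unfold req. rewrite Hp, Hn, den_rabs, (proj2 (nsub_eq0 _ _) h).
  transitivity ((neg a + nsub (pos a) (neg a)) * den a)%model; [ring|rewrite (nsubK h); ring].
- assert (h' : le (pos a) (neg a)) by (destruct (le_lt_dec (pos a) (neg a)) as [|h']; [assumption|now destruct h; left]).
  rewrite kopp_val. apply val_eq. unfold req.
  rewrite Hp, Hn, den_rabs, den_ropp, neg_ropp, pos_ropp, (proj2 (nsub_eq0 _ _) h').
  transitivity ((pos a + nsub (neg a) (pos a)) * den a)%model; [ring|rewrite (nsubK h'); ring].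
Qed.

Definition ke (n : N) : rat := val (rmk (one M) (zero M) (pred (exp2 n))).

Lemma ke_pos (n : N) : 0 < ke n.
Proof.
unfold kzero, ke. rewrite klt_val. fractions. rewrite (pred_pos (exp2_pos n)).
match goal with |- lt ?L ?R =>
  replace L with (zero M) by ring; replace R with (one M) by ring end. exact lt01.
Qed.
Arguments ke_pos n : clear implicits.

Lemma ke_S (n : N) : ke n = ke (n + one M)%model + ke (n + one M)%model.
Proof.
unfold ke. rewrite kadd_val. apply val_eq. fractions. rewrite !pred_pos by apply exp2_pos.
rewrite exp2_S. ring.
Qed.

Lemma ke_S_le (n : N) : ke (n + one M)%model <= ke n.
Proof.
rewrite (ke_S n). refine (kle_by (klt_kle (ke_pos (n + one M)%model)) _). ring.
Qed.

(** * Values of formal rational terms *)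

Section Evaluation.

Variables (G : ctx) (e : env M G).
Implicit Types a b c n : tm G O0.

Lemma eval_add a b : eval e (a + b)%tm = (eval e a + eval e b)%model.
Proof. reflexivity. Qed.
Lemma eval_mul a b : eval e (a * b)%tm = (eval e a * eval e b)%model.
Proof. reflexivity. Qed.
Lemma eval_tpred a : eval e (tpred a) = pred (eval e a).
Proof. reflexivity. Qed.
Lemma eval_tsubn a b : eval e (tsubn a b) = nsub (eval e a) (eval e b).
Proof. reflexivity. Qed.
Lemma eval_tcond c a b : eval e (tcond c a b) = cond (eval e c) (eval e a) (eval e b).
Proof. reflexivity. Qed.
Lemma eval_texp2 n : eval e (texp2 n) = exp2 (eval e n).
Proof. reflexivity. Qed.

Local Transparent pos neg den rmk.

Lemma eval_qpos a : eval e (qpos a) = pos (eval e a).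
Proof. reflexivity. Qed.
Lemma eval_qneg a : eval e (qneg a) = neg (eval e a).
Proof. reflexivity. Qed.
Lemma eval_qden a : eval e (qden a) = den (eval e a).
Proof. reflexivity. Qed.
Lemma eval_qmk a b c : eval e (qmk a b c) = rmk (eval e a) (eval e b) (eval e c).
Proof. reflexivity. Qed.

Local Opaque pos neg den rmk.

Local Ltac evaluate :=
  rewrite ?eval_qmk, ?eval_tpred, ?eval_add, ?eval_mul, ?eval_tsubn, ?eval_qpos, ?eval_qneg,
    ?eval_qden, ?eval_add, ?eval_mul, ?eval_tsubn, ?eval_qpos, ?eval_qneg, ?eval_qden, ?eval_texp2.

Lemma eval_qadd a b : eval e (qadd a b) = radd (eval e a) (eval e b).
Proof. unfold qadd. now evaluate. Qed.
Lemma eval_qopp a : eval e (qopp a) = ropp (eval e a).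
Proof. unfold qopp. now evaluate. Qed.
Lemma eval_qabs a : eval e (qabs a) = rabs (eval e a).
Proof. unfold qabs. now evaluate. Qed.

Lemma val_qadd a b : val (eval e (qadd a b)) = val (eval e a) + val (eval e b).
Proof. now rewrite eval_qadd, kadd_val. Qed.
Lemma val_qsub a b : val (eval e (qsub a b)) = val (eval e a) - val (eval e b).
Proof. unfold qsub, ksub. now rewrite val_qadd, eval_qopp, kopp_val. Qed.
Lemma val_qabs a : val (eval e (qabs a)) = kabs (val (eval e a)).
Proof. now rewrite eval_qabs, val_rabs. Qed.
Lemma val_qzero : val (eval e qzero) = 0.
Proof. unfold qzero. now evaluate. Qed.
Lemma val_qinv2 n : val (eval e (qinv2 n)) = ke (eval e n).
Proof. unfold qinv2. now evaluate. Qed.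
Lemma val_q2inv2 n : val (eval e (q2inv2 n)) = ke (eval e n) + ke (eval e n).
Proof.
unfold q2inv2, ke. evaluate. cbn [eval]. rewrite kadd_val. apply val_eq. fractions.
rewrite !pred_pos by apply exp2_pos. ring.
Qed.

Lemma sat_qlt a b : sat e (qlt a b) <-> val (eval e a) < val (eval e b).
Proof. unfold qlt. cbn [sat]. evaluate. symmetry. apply klt_val. Qed.

Lemma sat_qle a b : sat e (qle a b) <-> val (eval e a) <= val (eval e b).
Proof. unfold qle, fle. cbn [sat]. evaluate. symmetry. apply kle_val. Qed.

End Evaluation.

Lemma ke_le (n m : N) : le n m -> ke m <= ke n.
Proof.
intros h. destruct (le_exists h) as [k ->]. clear h.
assert (H : forall k, sat (econs k (econs n (enil M))) (qle (qinv2 (v1 + v0)) (qinv2 v1))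
              <-> ke (n + k)%model <= ke n).
{ clear k. intros k. now rewrite sat_qle, !val_qinv2, eval_add. }
apply (proj1 (H k)). revert k. apply qf_induction; [cbn; auto| |]; intros; apply (proj2 (H _)).
- rewrite add0. apply kle_refl.
- rewrite addA. apply (kle_trans (ke_S_le _)). now apply (proj1 (H _)).
Qed.

(** * Reals *)

Local Notation Fun := (dom M (O1 ⇒ O1)%ty).

Definition term (x : Seq) (n : N) : rat := val (x • n).

Definition isreal (x : Seq) : Prop :=
  forall n i, kabs (term x n - term x (n + i)%model) < ke n.
Definition eqreal (x y : Seq) : Prop :=
  forall n, kabs (term x n - term y n) <= ke n + ke n.
Definition inset (x : Seq) (F : Fun) : Prop :=
  exists n, ke n + ke n < kabs (term (F • x) n).
(** This is [|x - y| < c] unfolded: the shifted index stems from [subR] and the summand [2 * 2^-n]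
    from [ltR]. A sequence as bound covers both rational radii and real [ε]. *)
Definition distlt (x y : Seq) (c : N -> rat) : Prop :=
  exists n, kabs (term x (n + one M)%model - term y (n + one M)%model) + (ke n + ke n) < c n.

Section Satisfaction.

Variables (G : ctx) (e : env M G).
Implicit Types x y : tm G O1.

Lemma sat_is_real x : sat e (is_real x) <-> isreal (eval e x).
Proof.
unfold is_real, isreal. cbn [sat].
split; intros h n i; specialize (h n i); revert h;
  rewrite sat_qlt, val_qabs, val_qsub, val_qinv2; cbn [eval]; now rewrite !eval_twk.
Qed.

Lemma sat_eqR x y : sat e (eqR x y) <-> eqreal (eval e x) (eval e y).
Proof.
unfold eqR, eqreal. cbn [sat].
split; intros h n; specialize (h n); revert h;
  rewrite sat_qle, val_qabs, val_qsub, val_q2inv2; cbn [eval]; now rewrite !eval_twk.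
Qed.

Lemma sat_ltR x y : sat e (ltR x y) <->
  exists n, term (eval e x) n + (ke n + ke n) < term (eval e y) n.
Proof.
unfold ltR. cbn [sat].
split; intros [n h]; exists n; revert h;
  rewrite sat_qlt, val_qadd, val_q2inv2; cbn [eval]; now rewrite !eval_twk.
Qed.

Lemma term_absR x n : term (eval e (absR x)) n = kabs (term (eval e x) n).
Proof. unfold term, absR. rewrite lamE, val_qabs. cbn [eval]. now rewrite eval_twk. Qed.

Lemma term_subR x y n :
  term (eval e (subR x y)) n = term (eval e x) (n + one M)%model - term (eval e y) (n + one M)%model.
Proof. unfold term, subR. rewrite lamE, val_qsub. cbn [eval]. now rewrite !eval_twk. Qed.

Lemma term_ratR q n : term (eval e (ratR q)) n = val (eval e q).
Proof. unfold term, ratR. cbn [eval]. now rewrite PiE. Qed.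

Lemma sat_pos x : sat e (ltR zeroR x) <-> exists n, ke n + ke n < term (eval e x) n.
Proof.
rewrite sat_ltR. unfold zeroR.
split; intros [n h]; exists n; revert h; rewrite term_ratR, val_qzero;
  replace (0 + (ke n + ke n)) with (ke n + ke n) by ring; auto.
Qed.

Lemma sat_mem x (F : tm G (O1 ⇒ O1)%ty) : sat e (mem x F) <-> inset (eval e x) (eval e F).
Proof.
unfold mem, inset. rewrite sat_pos.
split; intros [n h]; exists n; revert h; now rewrite term_absR.
Qed.

Lemma sat_dist x y z : sat e (ltR (absR (subR x y)) z) <->
  distlt (eval e x) (eval e y) (fun n => term (eval e z) n).
Proof.
unfold distlt. rewrite sat_ltR.
split; intros [n h]; exists n; revert h; now rewrite term_absR, term_subR.
Qed.

Lemma sat_in_ball y x (r : tm G O0) : sat e (in_ball y x r) <->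
  distlt (eval e x) (eval e y) (fun _ => val (eval e r)).
Proof.
unfold in_ball, distlt. rewrite sat_dist. unfold distlt.
split; intros [n h]; exists n; revert h; now rewrite term_ratR.
Qed.

End Satisfaction.

Lemma eqreal_term (x y : Seq) (n : N) : eqreal x y ->
  term x n - term y n <= ke n + ke n /\ term y n - term x n <= ke n + ke n.
Proof.
intros h. specialize (h n). apply kle_kabs in h. destruct h as [h1 h2]. split; [assumption|].
replace (term y n - term x n) with (- (term x n - term y n)) by ring. exact h2.
Qed.

Lemma isreal_dist (x : Seq) (n m : N) : isreal x -> term x n - term x m < ke n + ke m.
Proof.
intros hx. destruct (le_lt_dec n m) as [h|h].
- destruct (le_exists h) as [i ->]. destruct (proj1 (klt_kabs _ _) (hx n i)) as [h1 _].
  refine (klt_by (klt_add2 h1 (klt_kle (ke_pos (n + i)%model))) _). ring.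
- destruct (le_exists (lt_le h)) as [i ->]. destruct (proj1 (klt_kabs _ _) (hx m i)) as [_ h1].
  refine (klt_by (klt_add2 h1 (klt_kle (ke_pos (m + i)%model))) _). ring.
Qed.
Arguments isreal_dist [x] n m _.

Lemma inset_eqreal (F : Fun) (x y : Seq) :
  isreal (F • x) -> eqreal (F • x) (F • y) -> inset x F -> inset y F.
Proof.
(* With [u = ke m] we have [ke k = 8u]. The value at [m] exceeds [16u - 9u - 2u = 5u] in modulus,
   and [2u] is required; two halvings instead of three would leave only [u]. *)
intros hx hxy [k hk]. set (m := (k + one M + one M + one M)%model). exists m.
pose proof (isreal_dist k m hx) as h1. pose proof (isreal_dist m k hx) as h2.
destruct (eqreal_term m hxy) as [h3 h4].
assert (hke : ke k = ke m + ke m + (ke m + ke m) + (ke m + ke m + (ke m + ke m))).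
{ unfold m. now rewrite (ke_S k), (ke_S (k + one M)%model), (ke_S (k + one M + one M)%model). }
pose proof (klt_kle (ke_pos m)) as h5. rewrite hke in *.
apply kabs_gt. apply kabs_gt in hk. destruct hk as [hk|hk]; [left|right].
- refine (klt_by (klt_add2 (klt_add2 hk (klt_kle h1)) (kle_add2 h3 (kle_add2 h5 (kle_add2 h5 h5)))) _).
  ring.
- refine (klt_by (klt_add2 (klt_add2 hk (klt_kle h2)) (kle_add2 h4 (kle_add2 h5 (kle_add2 h5 h5)))) _).
  ring.
Qed.

(** * The net *)

(** Zero stands for true, so the value serves directly as a condition of [tcond], and a conjunction
    of tests is a sum. *)
Definition tqlt (G : ctx) (a b : tm G O0) : tm G O0 :=
  tsubn (qpos a * qden b + qneg b * qden a + 1) (qpos b * qden a + qneg a * qden b).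

Lemma tqltE (G : ctx) (e : env M G) (a b : tm G O0) :
  eval e (tqlt a b) = zero M <-> val (eval e a) < val (eval e b).
Proof.
unfold tqlt. rewrite eval_tsubn, nsub_eq0, <- sat_qlt.
unfold qlt. cbn [sat]. rewrite eval_add. change (eval e 1) with (one M).
split; intros h.
- apply (lt_le_trans (lt_succ _) h).
- now apply lt_le_succ.
Qed.

(* An index is a sequence [d]: [d 0] is the precision, [d 1] a witness that the point of the
   net lies in [F], and [d 2, d 3, ...] codes that point.  Every sequence codes a real: the
   approximation is only updated when this keeps it within the prescribed modulus. *)
Definition tpoint : tm [] (O1 ⇒ O1) :=
  lam (tRec · lam (lam (tcond
      (tqlt (qabs (qsub v0 (v2 · (v1 + 1 + 1 + 1)))) (qinv2 (v1 + 1)))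
      (v2 · (v1 + 1 + 1 + 1)) v0)) · (v0 · (1 + 1)))%tm.

Definition point : Fun := eval (enil M) tpoint.

Lemma point0 (d : Seq) : point • d • zero M = d • (one M + one M)%model.
Proof. unfold point, tpoint. rewrite lamE. cbn [eval]. now rewrite RecE0. Qed.

Lemma pointS (d : Seq) (n : N) (y : N) : y = d • (n + one M + one M + one M)%model ->
  kabs (term (point • d) n - val y) < ke (n + one M)%model /\
    point • d • (n + one M)%model = y \/
  ~ kabs (term (point • d) n - val y) < ke (n + one M)%model /\
    point • d • (n + one M)%model = point • d • n.
Proof.
intros ->. unfold term.
set (r := point • d • n). unfold point, tpoint. rewrite lamE. cbn [eval].
rewrite RecES, !lamE, eval_tcond.
match goal with |- context [cond (eval ?e ?t) _ _] => set (c := eval e t);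
  assert (Hc : c = zero M <->
    kabs (val r - val (d • (n + one M + one M + one M)%model)) < ke (n + one M)%model) end.
{ unfold c. rewrite tqltE, val_qabs, val_qsub, val_qinv2. cbn [eval econs vcase].
  unfold r, point, tpoint. rewrite lamE. reflexivity. }
destruct (classic (c = zero M)) as [h|h]; [left|right].
- split; [now apply Hc|]. now rewrite h, cond0.
- split; [now rewrite <- Hc|]. rewrite condS by assumption.
  unfold r, point, tpoint. now rewrite lamE.
Qed.

(** Accepted or not, an update moves the approximation by less than [2^-(k+1)]. The invariant
    [|x_n - x_(n+k)| + 2^-(n+k) <= 2^-n] is preserved by such steps, and its second summand makes
    the final bound strict. *)
Lemma point_real (d : Seq) : isreal (point • d).
Proof.
intros n i. set (x := point • d).
assert (step : forall k, kabs (term x k - term x (k + one M)%model) < ke (k + one M)%model).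
{ intros k. unfold term at 2. destruct (pointS (d := d) (n := k) eq_refl) as [[h E]|[_ E]]; fold x in E; rewrite E.
  - exact h.
  - fold (term x k). replace (term x k - term x k) with 0 by ring. apply klt_kabs.
    replace (- 0) with 0 by ring. auto using ke_pos. }
assert (H : forall k, sat (econs k (econs n (econs x (enil M))))
    (qle (qadd (qabs (qsub (v2 · v1) (v2 · (v1 + v0)))) (qinv2 (v1 + v0))) (qinv2 v1))
  <-> kabs (term x n - term x (n + k)%model) + ke (n + k)%model <= ke n).
{ intros k. now rewrite sat_qle, val_qadd, val_qabs, val_qsub, !val_qinv2. }
assert (H' : kabs (term x n - term x (n + i)%model) + ke (n + i)%model <= ke n).
{ apply (proj1 (H i)). revert i.
  apply qf_induction; [cbn; auto| |]; [|intros k hk]; apply (proj2 (H _)).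
  - rewrite add0. replace (term x n - term x n) with 0 by ring.
    destruct (kabs_cases 0) as [[_ ->]|[_ ->]]; refine (kle_by (kle_refl 0) _); ring.
  - apply (proj1 (H _)) in hk. rewrite addA. set (m := (n + k)%model) in *.
    rewrite (ke_S m) in hk. specialize (step m). apply klt_kle, kle_kabs in step.
    destruct step as [s1 s2].
    assert (hk' : kabs (term x n - term x m) <= ke n - (ke (m + one M)%model + ke (m + one M)%model))
      by (refine (kle_by hk _); ring).
    apply kle_kabs in hk'. destruct hk' as [h1 h2].
    assert (hg : kabs (term x n - term x (m + one M)%model) <= ke n - ke (m + one M)%model).
    { apply kle_kabs. split.
      - refine (kle_by (kle_add2 h1 s1) _). ring.
      - refine (kle_by (kle_add2 h2 s2) _). ring. }
    refine (kle_by hg _). ring. }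
intros h. apply (ke_pos (n + i)%model). refine (kle_by (kle_add2 H' h) _). ring.
Qed.
Arguments point_real d : clear implicits.

(** The test for entry [n + 1] demands a change below [2^-(n+1)], whereas [y_n] and [y_(n+1)] are
    only within [2^-n]. Starting from [y_1] supplies the missing factor 2, so that no update is
    refused. *)
Lemma point_shift (d y : Seq) : isreal y ->
  (forall k, d • (k + one M + one M)%model = y • (k + one M)%model) ->
  forall n, point • d • n = y • (n + one M)%model.
Proof.
intros hy hd.
apply (qf_induction (e := econs (point • d) (econs y (enil M))) (A := (v1 · v0 ≡ v2 · (v0 + 1))%fm)).
- cbn; auto.
- change (point • d • zero M = y • (zero M + one M)%model). rewrite point0, <- hd. do 2 f_equal. ring.
- intros n. change (point • d • n = y • (n + one M)%model ->
    point • d • (n + one M)%model = y • (n + one M + one M)%model).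
  intros E. destruct (pointS (d := d) (n := n) (eq_sym (hd (n + one M)%model))) as [[_ E']|[h _]]; [assumption|].
  destruct h. unfold term. rewrite E. exact (hy (n + one M)%model (one M)).
Qed.

Lemma point_shift_eqreal (d y : Seq) : isreal y ->
  (forall k, d • (k + one M + one M)%model = y • (k + one M)%model) -> eqreal y (point • d).
Proof.
intros hy hd n. unfold term at 2. rewrite (point_shift hy hd). fold (term y (n + one M)%model).
apply klt_kle. pose proof (klt_kle (ke_pos n)) as hn.
destruct (proj1 (klt_kabs _ _) (hy n (one M))) as [h1 h2]. apply klt_kabs. split.
- refine (klt_by (klt_add2 h1 hn) _). ring.
- refine (klt_by (klt_add2 h2 hn) _). ring.
Qed.

(* Under the abstraction of the index [v0], the variables [v1], [v2] and [v3] stand for [point],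
   the limit and the set. *)
Definition tindex : tm [O1 ⇒ O1; O1; O1 ⇒ O1]%ty (O1 ⇒ O0) :=
  lam (tsubn 1
    (tqlt (qabs (qsub (v2 · (v0 · 0)) (v1 · v0 · (v0 · 0))))
       (qadd (q2inv2 (v0 · 0)) (q2inv2 (v0 · 0)))
     + tqlt (q2inv2 (v0 · 1)) (qabs (v3 · (v1 · v0) · (v0 · 1)))))%tm.

Definition index (x : Seq) (F : Fun) : dom M (O1 ⇒ O0)%ty :=
  eval (econs point (econs x (econs F (enil M)))) tindex.

Definition torder : tm [] (O1 ⇒ O1 ⇒ O0) := lam (lam (tsubn 1 (tsubn (v1 · 0) (v0 · 0))))%tm.

Definition order : dom M (O1 ⇒ O1 ⇒ O0)%ty := eval (enil M) torder.

Lemma nsub1 (x : N) : le (nsub (one M) x) (one M) /\ (nsub (one M) x = one M <-> x = zero M).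
Proof.
destruct (zero_or_succ x) as [->|E].
- rewrite nsub0. split; [apply le_refl|tauto].
- rewrite E. assert (E1 : nsub (one M) (pred x + one M)%model = zero M).
  { apply nsub_eq0. rewrite addC. apply le_addr. }
  rewrite E1. split; [apply ge0|]. split; intros h; exfalso.
  + apply (lt_irr (x := zero M)). rewrite h at 2. exact lt01.
  + pose proof (lt0_succ (pred x)) as h'. rewrite h in h'. now apply lt_irr in h'.
Qed.

Lemma index_le1 (x : Seq) (F : Fun) (d : Seq) : le (index x F • d) (one M).
Proof. unfold index, tindex. rewrite lamE, eval_tsubn. apply nsub1. Qed.

Lemma add_eq0 (x y : N) : (x + y)%model = zero M <-> x = zero M /\ y = zero M.
Proof.
split; [|intros [-> ->]; apply add0].
intros E. assert (hx : x = zero M).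
{ apply le_antisym; [rewrite <- E; apply le_addr|apply ge0]. }
split; [assumption|]. rewrite <- E, hx. ring.
Qed.

(** The sum of the two tests is 0 exactly when both succeed, and subtracting it from 1 turns this
    into the value 1. *)
Lemma indexE (x : Seq) (F : Fun) (d : Seq) (n w : N) : n = d • zero M -> w = d • one M ->
  index x F • d = one M <->
  kabs (term x n - term (point • d) n) < ke n + ke n + (ke n + ke n) /\
  ke w + ke w < kabs (term (F • (point • d)) w).
Proof.
intros -> ->. unfold index, tindex. rewrite lamE, eval_tsubn.
change (eval _ 1%tm) with (one M). rewrite (proj2 (nsub1 _)), eval_add, add_eq0, !tqltE.
rewrite !val_qabs, val_qsub, val_qadd, !val_q2inv2. reflexivity.
Qed.

Lemma order_le1 (d e : Seq) : le (order • d • e) (one M).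
Proof. unfold order, torder. rewrite !lamE, eval_tsubn. apply nsub1. Qed.

Lemma orderE (d e : Seq) : order • d • e = one M <-> le (d • zero M) (e • zero M).
Proof.
unfold order, torder. rewrite !lamE, eval_tsubn. change (eval _ 1%tm) with (one M).
rewrite (proj2 (nsub1 _)), eval_tsubn. apply nsub_eq0.
Qed.

(** The entries are [n], [w], [y 1], [y 2], and so on: [y 0] is dropped, as [point_shift]
    requires. *)
Definition tcode : tm [O0; O0; O1] O1 :=
  lam (tcond v0 v1 (tcond (tpred v0) v2 (v3 · tpred v0)))%tm.

Lemma code_exists (n w : N) (y : Seq) : exists d : Seq,
  d • zero M = n /\ d • one M = w /\
  forall k, d • (k + one M + one M)%model = y • (k + one M)%model.
Proof.
exists (eval (econs n (econs w (econs y (enil M)))) tcode). unfold tcode.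
assert (h1 : one M <> zero M) by (intros h; apply (lt_irr (x := zero M)); rewrite <- h at 2; exact lt01).
assert (hS : forall k, (k + one M)%model <> zero M).
{ intros k h. pose proof (lt0_succ k) as h'. rewrite h in h'. now apply lt_irr in h'. }
split; [|split]; [| |intros k]; rewrite lamE, !eval_tcond.
- apply cond0.
- cbn [eval econs vcase]. rewrite condS, eval_tpred by assumption. cbn [eval econs vcase].
  replace (pred (one M)) with (zero M); [apply cond0|].
  rewrite <- (pred_succ (zero M)). f_equal. ring.
- cbn [eval econs vcase]. rewrite condS, eval_tpred by apply hS. cbn [eval econs vcase].
  rewrite pred_succ. now rewrite condS by apply hS.
Qed.

(** * Convergence of the net to an adherent point *)

Section Limit.

Variables (x : Seq) (F : Fun).
Hypothesis x_real : isreal x.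
Hypothesis F_real : forall y, isreal y -> isreal (F • y).
Hypothesis F_ext : forall y z, isreal y -> isreal z -> eqreal y z -> eqreal (F • y) (F • z).
Hypothesis x_adherent : forall n, exists y, isreal y /\ distlt x y (fun _ => ke n) /\ inset y F.

(** The stored witness must concern [F] at the decoded point, which is only equal to [y] as a real.
    Hence two codes: one to obtain the point and then the witness [w], another that stores [w]. Both
    decode to the same point because decoding does not read entries 0 and 1. *)
Lemma index_exists (n : N) : exists d, d • zero M = n /\ index x F • d = one M.
Proof.
destruct (x_adherent n) as [y [hy [[k hk] hyF]]].
(* The second [n] is a placeholder for the witness not yet known. *)
destruct (code_exists n n y) as [d' [_ [_ hd']]].
destruct (inset_eqreal (F_real hy) (F_ext hy (point_real d') (point_shift_eqreal hy hd')) hyF) as [w hw].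
destruct (code_exists n w y) as [d [h0 [h1 hd]]].
assert (E : point • d = point • d').
{ apply M_ext. intros i. now rewrite (point_shift hy hd), (point_shift hy hd'). }
exists d. split; [assumption|].
apply (indexE x F (eq_sym h0) (eq_sym h1)). rewrite E. split; [|exact hw].
rewrite <- E. unfold term at 2. rewrite (point_shift hy hd). fold (term y (n + one M)%model).
set (k' := (k + one M)%model) in *.
assert (hk' : kabs (term x k' - term y k') < ke n - (ke k + ke k))
  by (refine (klt_by hk _); ring).
apply klt_kabs in hk'. destruct hk' as [a1 a2].
(* The path from [x_n] through [x_k'] and [y_k'] to [y_(n+1)] costs less than [ke n + ke k'],
   [ke n - 2 ke k] and [ke k' + ke (n+1)]. By [b] the total is below [3 ke n], and [c] pads it to
   the [4 ke n] of the index set. *)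
assert (b : ke (n + one M)%model + (ke k' + ke k') <= ke n + (ke k + ke k))
  by (apply kle_add2; [|apply kle_add2]; apply ke_S_le).
pose proof (klt_kle (ke_pos n)) as c.
pose proof (klt_kle (isreal_dist n k' x_real)) as x1.
pose proof (klt_kle (isreal_dist k' n x_real)) as x2.
pose proof (klt_kle (isreal_dist (n + one M)%model k' hy)) as y1.
pose proof (klt_kle (isreal_dist k' (n + one M)%model hy)) as y2.
apply klt_kabs. split.
- refine (klt_by (klt_add2 a1 (kle_add2 (kle_add2 x1 y2) (kle_add2 b c))) _). ring.
- refine (klt_by (klt_add2 a2 (kle_add2 (kle_add2 x2 y1) (kle_add2 b c))) _). ring.
Qed.

Lemma index_limit (r : Seq) (k : N) : isreal r -> ke k + ke k < term r k ->
  exists d, index x F • d = one M /\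
    forall d', index x F • d' = one M -> order • d • d' = one M ->
      distlt (point • d') x (term r).
Proof.
(* Let [u = ke (j+1)], so [ke k = 16u] and [r_j > 32u - 18u = 14u]. For an index of precision at
   least [j + 1], the terms number [j + 1] of its point and of [x] differ by less than [8u]; with
   the [2 ke j = 4u] demanded by [distlt] this makes [12u]. *)
intros hr hk. set (j := (k + one M + one M + one M)%model).
destruct (index_exists (j + one M)%model) as [d [hd0 hd]]. exists d. split; [assumption|].
intros d' hd' hle. apply orderE in hle. rewrite hd0 in hle.
apply (indexE x F eq_refl eq_refl) in hd' as [hn _].
set (n := d' • zero M) in *. exists j. set (j' := (j + one M)%model) in *.
apply ke_le in hle.
assert (hj : ke j = ke j' + ke j') by apply ke_S.
assert (hkj : ke k = ke j + ke j + (ke j + ke j) + (ke j + ke j + (ke j + ke j))).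
{ unfold j. now rewrite (ke_S k), (ke_S (k + one M)%model), (ke_S (k + one M + one M)%model). }
pose proof (isreal_dist k j hr) as hrj. rewrite hkj, hj in *. set (u := ke j') in *.
pose proof (klt_kle (ke_pos j')) as hu. fold u in hu.
apply klt_kabs in hn. destruct hn as [n1 n2].
pose proof (klt_kle (isreal_dist j' n x_real)) as x1.
pose proof (klt_kle (isreal_dist n j' x_real)) as x2.
pose proof (klt_kle (isreal_dist j' n (point_real d'))) as y1.
pose proof (klt_kle (isreal_dist n j' (point_real d'))) as y2.
fold u in x1, x2, y1, y2.
pose proof (kle_add2 hle (kle_add2 hle hle)) as h3.
pose proof (kle_add2 h3 h3) as h6.
assert (hr' : u + u + (u + u) + (u + u + (u + u)) + (u + u + (u + u)) + (u + u) < term r j)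
  by (refine (klt_by (klt_add2 hk (klt_kle hrj)) _); ring).
assert (g : kabs (term (point • d') j' - term x j') < u + u + (u + u) + (u + u + (u + u))).
{ apply klt_kabs. split.
  - refine (klt_by (klt_add2 n2 (kle_add2 (kle_add2 x2 y1) h6)) _). ring.
  - refine (klt_by (klt_add2 n1 (kle_add2 (kle_add2 x1 y2) h6)) _). ring. }
refine (klt_by (klt_add2 g (kle_add2 (klt_kle hr') (kle_add2 hu hu))) _). ring.
Qed.

End Limit.

(** * The theorem in an arbitrary model *)

Lemma sat_real_function (G : ctx) (e : env M G) (f : tm G (O1 ⇒ O1)%ty) :
  sat e (real_function f) ->
  (forall y, isreal y -> isreal (eval e f • y)) /\
  (forall y z, isreal y -> isreal z -> eqreal y z -> eqreal (eval e f • y) (eval e f • z)).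
Proof.
intros [h1 h2]. cbn [sat] in h1, h2. split.
- intros y hy. specialize (h1 y). rewrite !sat_is_real in h1. cbn [eval] in h1.
  rewrite eval_twk in h1. exact (h1 hy).
- intros y z hy hz hyz. specialize (h2 y z). rewrite !sat_is_real, !sat_eqR in h2. cbn [eval] in h2.
  rewrite !eval_twk in h2. exact (h2 hy hz hyz).
Qed.

Lemma sat_net_closed_closed :
  sat (enil M) (∀[O1 ⇒ O1] real_function v0 ⊃ net_closed v0 ⊃ is_closed v0)%fm.
Proof.
cbn [sat]. intros F HF HN. apply sat_real_function in HF as [F_real F_ext].
change (eval (econs F (enil M)) v0) with F in F_real, F_ext.
unfold is_closed, is_open. cbn [sat]. intros x Hx Hxc. apply sat_is_real in Hx.
change (isreal x) in Hx. apply NNPP. intros Hopen. apply Hxc. clear Hxc. apply sat_mem.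
change (inset x F).
(* If some ball of radius [2^-n] about [x] missed [F], it would witness the openness of the
   complement at [x], contrary to [Hopen]. *)
assert (x_adherent : forall n, exists y, isreal y /\ distlt x y (fun _ => ke n) /\ inset y F).
{ intros n. apply NNPP. intros Hn. apply Hopen.
  exists (rmk (one M) (zero M) (pred (exp2 n))). split.
  - apply sat_qlt. rewrite val_qzero. exact (ke_pos n).
  - intros y Hy Hb. apply sat_is_real in Hy. apply sat_in_ball in Hb. apply sat_fren.
    intros Hm. apply sat_mem in Hm. apply Hn. exists y. split; [exact Hy|]. split; [exact Hb|exact Hm]. }
specialize (HN (index x F) order point x). apply sat_mem in HN; [exact HN| | |split].
- split; [split|split; [split; [|split; [|split]]|]].
  + intros d. exact (index_le1 x F d).
  + intros d d'. exact (order_le1 d d').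
  + destruct (index_exists Hx F_real F_ext x_adherent (zero M)) as [d [_ hd]]. exists d. exact hd.
  + intros d _. apply orderE, le_refl.
  + intros d d' d'' _ _ _ h h'. apply orderE in h, h'. apply orderE. exact (le_trans h h').
  (* Precisions are linearly ordered, so the more precise of two indices is an upper bound of
     both. *)
  + intros d d' hd hd'. destruct (le_lt_dec (d • zero M) (d' • zero M)) as [h|h].
    * exists d'. split; [exact hd'|]. split; apply orderE; [exact h|apply le_refl].
    * exists d. split; [exact hd|]. split; apply orderE; [apply le_refl|exact (lt_le h)].
  + intros d _. apply sat_is_real. exact (point_real d).
- apply sat_is_real. exact Hx.
- intros d hd. apply sat_mem. exists (d • one M).
  exact (proj2 (proj1 (indexE x F eq_refl eq_refl) hd)).
- intros r Hr Hpos. apply sat_is_real in Hr. apply sat_pos in Hpos as [k hk].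
  destruct (index_limit Hx F_real F_ext x_adherent Hr hk) as [d [hd Hd]].
  exists d. split; [exact hd|]. intros d' hd' hle. apply sat_dist. exact (Hd d' hd' hle).
Qed.

End Model.

Theorem theorem4p15 :
  provable RCA0omega
    (∀[O1 ⇒ O1] real_function v0 ⊃ net_closed v0 ⊃ is_closed v0)%fm.
Proof.
apply completeness.
- exact RCA0omega_sub_closed.
- intros G s t f x y. apply rca_ext.
- exact sat_net_closed_closed.
Qed.
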